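(* For every integer $d\ge10$, $$p_c(d)<p_{shield}(d)\le p_{fin}(d).$$
   Context: Let $\mathcal{E}^d$ be the set of nearest-neighbor edges of $\mathbb{Z}^d$. For $p\in[0,1]$, $\mathbb{P}_p$ is the product measure on $\{0,1\}^{\mathcal{E}^d}$ under which each edge $e$ is independently open ($\omega(e)=1$) with probability $p$ and closed ($\omega(e)=0$) with probability $1-p$. A path is an alternating sequence of vertices and edges $v_0,e_0,v_1,e_1,\dots$ in which $e_i\in\mathcal{E}^d$ has endpoints $v_i$ and $v_{i+1}$. Clusters are the equivalence classes of vertices of $\mathbb{Z}^d$ under the relation of being joined by a path of open edges. The percolation threshold is $$p_c(d)=\inf\{p\in[0,1]:\mathbb{P}_p(\text{there is an infinite cluster})>0\}.$$ Let $X$ be the (random) subgraph of $\mathbb{Z}^d$ (with its nearest-neighbor edges, open or closed) obtained after removing all vertices in the infinite cluster, together with all edges incident to them (if an infinite cluster exists, it is a.s. unique; if there is none, $X=\mathbb{Z}^d$). Define $$p_{fin}(d)=\sup\{p\in[0,1]:\mathbb{P}_p(X\text{ has an infinite connected component})>0\}.$$ A vertex $x\in\mathbb{Z}^d$ is shielded if all $2d$ edges incident to $x$ are closed. A shielded path is a path all of whose vertices are shielded; an infinite shielded path is understood to be an infinite vertex self-avoiding one (vertices $v_0,v_1,v_2,\dots$ all distinct). Define $$p_{shield}(d)=\sup\{p\in[0,1]:\mathbb{P}_p(\text{there exists an infinite shielded path})>0\}.$$ *)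

(* Defs.v *)
From HB Require Import structures.
From mathcomp Require Import all_boot all_order all_algebra.
From mathcomp Require Import all_classical all_reals all_analysis.
From mathcomp Require Import measurable_realfun.
From mathcomp Require Import zify.
From mathcomp Require Import ring lra.

Set Implicit Arguments.
Unset Strict Implicit.
Unset Printing Implicit Defensive.

Import Order.TTheory GRing.Theory Num.Theory.

Local Open Scope classical_set_scope.
Local Open Scope ring_scope.

Definition cylinder1 (I : Type) : set (set (I -> bool)) :=
  [set [set w : I -> bool | w i] | i in [set: I]].

Definition config (I : Type) := g_sigma_algebraType (@cylinder1 I).

(* [P] is the product over [I] of the Bernoulli([p]) laws. *)
Definition is_bernoulli_product (R : realType) (I : choiceType) (p : R)
    (P : probability (config I) R) :=
  forall (s : seq I) (b : I -> bool), uniq s ->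
    P [set w | forall i, i \in s -> w i = b i] =
    (\prod_(i <- s) (if b i then p else 1 - p))%:E.

(* Existence: the successive "digits" of a uniform point of [0, 1[, where the
   digit of x is [x < p], after which [0, p[ and [p, 1[ are rescaled to
   [0, 1[, are independent Bernoulli([p]) variables. *)
Section bernoulli_product_exists.
Context {R : realType} (p : R).

Let expand (x : R) : R := if x < p then x / p else (x - p) / (1 - p).

Let digit n (x : R) : bool := iter n expand x < p.

Let fits (c : option bool) (b : bool) := if c is Some b' then b == b' else true.

Let wt (c : option bool) : R :=
  if c is Some b then (if b then p else 1 - p) else 1.

Let ok := fix ok (s : seq (option bool)) (x : R) : bool :=
  (0 <= x < 1) &&
  (if s is c :: s' then fits c (x < p) && ok s' (expand x) else true).

Let mexpand : measurable_fun [set: measurableTypeR R]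
  (expand : measurableTypeR R -> measurableTypeR R).
Proof.
apply: measurable_fun_ifT.
- exact: measurable_fun_ltr.
- exact: measurable_funM.
- by apply: measurable_funM => //; exact: measurable_funB.
Qed.

Let mdigit n : measurable_fun [set: measurableTypeR R]
  (digit n : measurableTypeR R -> bool).
Proof.
apply: measurable_fun_ltr => //.
elim: n => [|n ih] /=; first exact: measurable_id.
exact: (measurableT_comp mexpand ih).
Qed.

Let mokb s : measurable_fun [set: measurableTypeR R]
  (ok s : measurableTypeR R -> bool).
Proof.
have m01 : measurable_fun [set: measurableTypeR R]
    ((fun x => 0 <= x < 1) : measurableTypeR R -> bool).
  by apply: measurable_and; [exact: measurable_fun_ler|exact: measurable_fun_ltr].
elim: s => [|c s ih] /=; first exact: measurable_and.
apply: measurable_and => //; apply: measurable_and.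
  have md : measurable_fun [set: measurableTypeR R]
      ((fun x => x < p) : measurableTypeR R -> bool).
    exact: measurable_fun_ltr.
  by case: c => [b|] /=; [exact: (measurableT_comp (f := eq_op^~ b))|].
exact: (measurableT_comp ih mexpand).
Qed.

Let mok s : measurable (ok s : set (measurableTypeR R)).
Proof.
have := mokb s measurableT (Y := [set true]) Logic.I; rewrite setTI.
by congr measurable; apply/seteqP; split=> x /=.
Qed.

Hypothesis p01 : 0 <= p <= 1.

Let ok01 s x : ok s x -> 0 <= x < 1.
Proof. by case: s => [|c s] /= /andP[]. Qed.

Let expand01 x : 0 <= x < 1 -> 0 <= expand x < 1.
Proof.
move=> /andP[x0 x1]; rewrite /expand; case: ltP => xp.
  have p0 : 0 < p by lra.
  by apply/andP; split; [apply: divr_ge0; lra | rewrite ltr_pdivrMr//; lra].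
have p1 : 0 < 1 - p by lra.
by apply/andP; split; [apply: divr_ge0; lra | rewrite ltr_pdivrMr//; lra].
Qed.

Let okP s x : ok s x <->
  (0 <= x < 1 /\ forall n, (n < size s)%N -> fits (nth None s n) (digit n x)).
Proof.
elim: s x => [|c s ih] x /=; first by rewrite andbT; split=> [|[]].
split=> [/andP[x01 /andP[cx /ih[_ h]]]|[x01 h]].
  split=> // -[|n] //= ns; have := h n ns.
  by rewrite /digit iterSr.
rewrite x01 (h 0%N)//=; apply/ih; split; first exact: expand01.
by move=> n ns; have := h n.+1 ns; rewrite /digit iterSr.
Qed.

Let wt_ge0 c : 0 <= wt c.
Proof. by have [? ?] := andP p01; rewrite /wt; case: c => [[]|] //=; lra. Qed.

Let ok_word (w : seq bool) : exists a, [/\ 0 <= a,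
  a + \prod_(b <- w) wt (Some b) <= 1 &
  forall x, ok (map Some w) x = (a <= x < a + \prod_(b <- w) wt (Some b))].
Proof.
elim: w => [|b w [a [a0 al1 aE]]].
  by exists 0; rewrite big_nil add0r; split => // x /=; rewrite andbT.
rewrite big_cons; set l := \prod_(_ <- _) _ in al1 aE *.
have l0 : 0 <= l by apply: prodr_ge0.
have [p0 p1] := andP p01.
rewrite /wt; case: b => /=.
- have pl0 : 0 <= p * l by apply: mulr_ge0.
  have pal1 : p * (a + l) <= p by rewrite ler_piMr.
  have pa0 : 0 <= p * a by apply: mulr_ge0.
  exists (p * a); split; [by []|lra|] => x.
  rewrite /= aE /expand eqb_id; have [xp|xp] := ltP x p => /=; last first.
    by rewrite ?andbF; apply/esym/negbTE/negP => /andP[? ?]; lra.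
  have [pp|pp] := ltP 0 p; last first.
    have -> : p = 0 by lra.
    by rewrite invr0 mulr0 !mul0r; apply/idP/idP; lra.
  by rewrite ler_pdivlMr// ltr_pdivrMr//; apply/idP/idP; lra.
- set q := 1 - p; have pq1 : p + q = 1 by rewrite /q; lra.
  have q0 : 0 <= q by rewrite /q; lra.
  have ql0 : 0 <= q * l by apply: mulr_ge0.
  have qal1 : q * (a + l) <= q by rewrite ler_piMr.
  have qa0 : 0 <= q * a by apply: mulr_ge0.
  exists (p + q * a); split; [lra|lra|] => x.
  rewrite /= aE /expand -/q eqbF_neg -leNgt; have [xp|xp] := ltP x p => /=.
    by rewrite ?andbF; apply/esym/negbTE/negP => /andP[? ?]; lra.
  have [x1|x1] := ltP x 1; last first.
    by rewrite andbF /=; apply/esym/negbTE/negP => /andP[? ?]; lra.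
  have qq : 0 < q by rewrite /q; lra.
  by rewrite ler_pdivlMr// ltr_pdivrMr//; apply/idP/idP; lra.
Qed.

Let mu_ok (s : seq (option bool)) : lebesgue_measure (ok s : set (measurableTypeR R)) =
  (\prod_(c <- s) wt c)%:E.
Proof.
suff h (w : seq bool) : lebesgue_measure (ok (map Some w ++ s) : set (measurableTypeR R)) =
  (\prod_(c <- map Some w ++ s) wt c)%:E by exact: (h [::]).
elim: s w => [|[b|] s ih] w.
- rewrite cats0 big_map; have [a [a0 al1 aE]] := ok_word w.
  set l := \prod_(_ <- _) _ in al1 aE *.
  have l0 : 0 <= l by apply: prodr_ge0.
  rewrite (_ : ok _ = [set` `[a, a + l[] :> set R); last first.
    by apply/seteqP; split=> x /=; rewrite aE in_itv.
  rewrite lebesgue_measure_itv/= lte_fin; case: ltP => al.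
    by rewrite -EFinD addrAC subrr add0r.
  by congr EFin; lra.
- by have := ih (rcons w b); rewrite map_rcons cat_rcons.
- have h1 := ih (rcons w true); have h0 := ih (rcons w false).
  rewrite !map_rcons !cat_rcons in h1 h0.
  rewrite (_ : ok _ = (ok (map Some w ++ Some true :: s) : set R) `|`
     (ok (map Some w ++ Some false :: s)) :> set (measurableTypeR R)).
    rewrite measureU//; last first.
      apply/seteqP; split=> x //= -[/okP[_ h1x] /okP[_ h0x]].
      have ltn c : (size w < size (map Some w ++ c :: s))%N.
        by rewrite size_cat size_map /= -addSnnS ltn_addr.
      have := h1x _ (ltn _); have := h0x _ (ltn _).
      by rewrite !nth_cat !size_map !ltnn !subnn /= => /eqP ->.
    transitivity (((\prod_(c <- map Some w ++ Some true :: s) wt c)%:E +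
      (\prod_(c <- map Some w ++ Some false :: s) wt c)%:E)%E).
      by congr (_ + _)%E.
    by rewrite -EFinD !big_cat/= !big_cons/=; congr EFin; ring.
  apply/seteqP; split=> x /=.
    move/okP => [x01 h].
    have hb b n : b = digit (size w) x ->
        (n < size (map Some w ++ Some b :: s))%N ->
        fits (nth None (map Some w ++ Some b :: s) n) (digit n x).
      move=> bE nw; have /h : (n < size (map Some w ++ None :: s))%N.
        by move: nw; rewrite !size_cat.
      rewrite !nth_cat size_map; case: ifP => // wn.
      have [->|nw'] := eqVneq n (size w); first by rewrite subnn /= bE.
      by have [k ->] : exists k, (n - size w = k.+1)%N
        by exists (n - size w).-1; lia.
    case db : (digit (size w) x); [left|right]; apply/okP; split=> // n;
      exact: hb.
  move=> h; apply/okP; split; first by case: h => /ok01.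
  move=> n nw; have h' b : ok (map Some w ++ Some b :: s) x ->
      fits (nth None (map Some w ++ None :: s) n) (digit n x).
    case/okP => _ /(_ n); rewrite !size_cat /= in nw * => /(_ nw).
    rewrite !nth_cat; case: ifP => // _.
    by case: (n - _)%N.
  by case: h => /h'.
Qed.

Let digit_word_measurable (I : countType) :
  measurable_fun [set: measurableTypeR R]
    ((fun x i => digit (pickle i) x) : measurableTypeR R -> config I).
Proof.
apply: (@measurability _ _ _ (config I) _ _ (@cylinder1 I)) => //.
move=> _ [_ [i _ <-] <-]; rewrite setTI.
have := mdigit (pickle i) measurableT (Y := [set true]) Logic.I; rewrite setTI.
by congr measurable; apply/seteqP; split=> x /=.
Qed.

Lemma bernoulli_product_exists (I : countType) :
  exists P : probability (config I) R, is_bernoulli_product p P.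
Proof.
pose X : {mfun measurableTypeR R >-> config I} :=
  HB.pack (fun x i => digit (pickle i) x : bool)
    (isMeasurableFun.Build _ _ _ _ _ (@digit_word_measurable I)).
have m01 : measurable ([set` `[0, 1[] : set (measurableTypeR R)).
  exact: measurable_itv.
have Q1 : mrestr (@lebesgue_measure R) m01 setT = 1%E.
  by rewrite /mrestr setTI lebesgue_measure_itv/= lte_fin ltr01 oppr0 adde0.
pose Q : probability (measurableTypeR R) R :=
  HB.pack (mrestr (@lebesgue_measure R) m01) (Measure_isProbability.Build _ _ _ _ Q1).
exists (distribution Q X) => s b us.
pose c n := if pickle_inv n is Some i then
  (if i \in s then Some (b i) else None) else None.
have [N sN] : exists N, forall i, i \in s -> (pickle i < N)%N.
  exists (\max_(i <- s) pickle i).+1 => i si.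
  by rewrite ltnS; exact: leq_bigmax_seq.
have XE : forall x, 0 <= x < 1 ->
   (forall i, i \in s -> digit (pickle i) x = b i) <-> ok (mkseq c N) x.
  move=> x x01; split=> h.
    apply/okP; split=> // n; rewrite size_mkseq => nN; rewrite nth_mkseq// /c.
    case ni : (pickle_inv n) => [i|//]; case: ifP => // /h /eqP.
    by rewrite /= (_ : pickle i = n)//; have := @pickle_invK I n; rewrite ni.
  move=> i si; case/okP : h => _ /(_ (pickle i)); rewrite size_mkseq sN// nth_mkseq ?sN//.
  by rewrite /c pickleK_inv si => /(_ isT)/eqP.
transitivity (lebesgue_measure (ok (mkseq c N) : set (measurableTypeR R))).
  rewrite /distribution /pushforward /= /mrestr; congr lebesgue_measure.
  apply/seteqP; split=> [x [h]|x h].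
    by rewrite /= in_itv /= => x01; apply/(XE _ x01).
  have x01 := @ok01 _ x h; split; last by rewrite /= in_itv.
  exact: (XE _ x01).2.
rewrite mu_ok /mkseq big_map; congr EFin.
rewrite (bigID (fun n => n \in map pickle s))/= [X in _ * X]big1 ?mulr1; last first.
  move=> n; rewrite /c; case ni : (pickle_inv n) => [i|//]; case: ifP => // si.
  have := @pickle_invK I n; rewrite ni /= => <-.
  by rewrite (map_f pickle si).
rewrite -big_filter (perm_big (map pickle s)) /=; last first.
  apply: uniq_perm.
  - by rewrite filter_uniq// iota_uniq.
  - by rewrite map_inj_uniq//; exact: (pcan_inj pickleK).
  move=> n; rewrite mem_filter mem_iota /= add0n.
  by case: mapP => // -[i /sN ? ->].
rewrite big_map big_seq [RHS]big_seq; apply: eq_bigr => i si.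
by rewrite /c pickleK_inv si.
Qed.

End bernoulli_product_exists.

Lemma is_bernoulli_product_unique (R : realType) (I : countType) (p : R)
    (P Q : probability (config I) R) :
  is_bernoulli_product p P -> is_bernoulli_product p Q ->
  forall A, measurable A -> P A = Q A.
Proof.
move=> hP hQ.
pose cyl (s : seq I) : set (config I) := [set w | forall i, i \in s -> w i].
pose G : set (set (config I)) := range cyl.
have cylE s : cyl s = [set w | forall i, i \in undup s -> w i = (fun=> true) i].
  by apply/seteqP; split=> w /= h i; [rewrite mem_undup => /h|move=> si; apply: h; rewrite mem_undup].
have mcyl s : measurable (cyl s).
  rewrite (_ : cyl s = \big[setI/setT]_(i <- s) [set w : config I | w i]).
    by apply: bigsetI_measurable => i _; apply: sub_sigma_algebra; exists i.
  rewrite -bigcap_seq; apply/seteqP; split=> w /= h i si; exact: (h i si).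
have GI : setI_closed G.
  move=> _ _ [s _ <-] [t _ <-]; exists (s ++ t) => //.
  apply/seteqP; split=> w /=.
    by move=> h; split=> i si; apply: h; rewrite mem_cat si ?orbT.
  by move=> [hs ht] i; rewrite mem_cat => /orP[/hs|/ht].
have sG : <<s @cylinder1 I >> `<=` <<s G >>.
  apply: sub_sigma_algebra2 => _ [i _ <-].
  exists [:: i] => //; apply/seteqP; split=> w /=.
    by move=> h; apply: h; rewrite inE.
  by move=> h j; rewrite inE => /eqP ->.
move=> A mA.
apply: (@g_sigma_algebra_measure_unique _ R (config I) G _ (fun=> setT)) => //.
- by move=> _ [s _ <-].
- move=> _; exists [::] => //; apply/seteqP; split=> w //=.
- by rewrite bigcup_const.
- by move=> _ [s _ <-]; rewrite cylE; exact: etrans (hP _ _ (undup_uniq s)) (esym (hQ _ _ (undup_uniq s))).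
- by move=> _; rewrite -ge0_fin_numE// fin_num_measure.
- exact: sG.
Qed.

Lemma bernoulli_product_exists_total (R : realType) (I : countType) (p : R) :
  exists P : probability (config I) R, 0 <= p <= 1 -> is_bernoulli_product p P.
Proof.
have [/bernoulli_product_exists/(_ I)[P hP]|_] := boolP (0 <= p <= 1).
  by exists P.
have h0 : 0 <= (0 : R) <= 1 by rewrite lexx ler01.
by have [P _] := bernoulli_product_exists h0 I; exists P.
Qed.

(* The value is irrelevant for [p] outside [0, 1]. *)
Definition bernoulli_product (R : realType) (I : countType) (p : R) :
    probability (config I) R :=
  projT1 (cid (bernoulli_product_exists_total I p)).

Lemma bernoulli_productP (R : realType) (I : countType) (p : R) :
  0 <= p <= 1 -> is_bernoulli_product p (bernoulli_product I p).
Proof. exact: (projT2 (cid (bernoulli_product_exists_total I p))). Qed.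

Section percolation.
Variable d : nat.

Definition vertex := 'rV[int]_d.

Definition neighbor (x y : vertex) : bool := \sum_i `|x 0 i - y 0 i| == 1.

(* [(x, i)] encodes the edge between [x] and [x + e_i]; each nearest-neighbor
   edge has exactly one such code, see [neighborP]. *)
Definition edge := (vertex * 'I_d)%type.

Definition endpoint1 (e : edge) : vertex := e.1.
Definition endpoint2 (e : edge) : vertex := e.1 + delta_mx 0 e.2.

Definition joins (e : edge) (x y : vertex) : bool :=
  (endpoint1 e == x) && (endpoint2 e == y) ||
  (endpoint1 e == y) && (endpoint2 e == x).

Definition incident (e : edge) (x : vertex) : bool :=
  (endpoint1 e == x) || (endpoint2 e == x).

Lemma neighborP x y : neighbor x y <-> exists! e, joins e x y.
Proof.
have sum_delta (i : 'I_d) : \sum_j `|(delta_mx 0 i : vertex) 0 j| = 1.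
  rewrite (bigD1 i)//= mxE !eqxx normr1 big1 ?addr0// => j /negbTE ji.
  by rewrite mxE ji andbF normr0.
split=> [/eqP xy1|[[z i] [/orP[]/andP[/eqP <- /eqP <-] _]]]; last first.
- rewrite /neighbor -(sum_delta i); apply/eqP; apply: eq_bigr => j _.
  by rewrite /endpoint1 /endpoint2 /= [in LHS]mxE addrAC subrr add0r.
- rewrite /neighbor -(sum_delta i); apply/eqP; apply: eq_bigr => j _.
  rewrite /endpoint1 /endpoint2 /= [in LHS]mxE opprD addrA subrr add0r.
  by rewrite normrN.
have [i zi] : exists i, x 0 i != y 0 i.
  apply/existsP; apply: contra_eqT xy1; rewrite negb_exists => /forallP h.
  by rewrite big1// => i _; move: (h i); rewrite negbK => /eqP ->; rewrite subrr normr0.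
have [zi1 z0] : `|x 0 i - y 0 i| = 1 /\ forall j, j != i -> x 0 j = y 0 j.
  move: xy1; rewrite (bigD1 i)//=; set r := \sum_(_ | _) _ => xy1.
  have r0 : 0 <= r by apply: sumr_ge0.
  have z1 : 1 <= `|x 0 i - y 0 i| by rewrite -gtz0_ge1 normr_gt0 subr_eq0.
  have r00 : r = 0 by lia.
  split; first by lia.
  move=> j ji; apply/eqP; rewrite -subr_eq0 -normr_eq0.
  by move/eqP: r00; rewrite psumr_eq0// => /allP/(_ j); rewrite mem_index_enum ji => /(_ isT).
have [zE|zE] : y 0 i = x 0 i + 1 \/ x 0 i = y 0 i + 1 by lia.
- have yE : y = x + delta_mx 0 i.
    apply/rowP => j; rewrite !mxE eqxx /=; have [->|/[dup] ji /z0 ->] := eqVneq j i => //.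
    by rewrite addr0.
  exists (x, i); split; first by rewrite /joins /endpoint1 /endpoint2 /= -yE !eqxx.
  move=> [z j] /orP[]/andP[/eqP]; rewrite /endpoint1 /endpoint2 /= => -> /eqP.
    rewrite yE => /addrI /rowP/(_ i); rewrite !mxE !eqxx /=.
    by case: eqVneq => // ->.
  rewrite yE => /rowP/(_ i); rewrite !mxE !eqxx /=; lia.
- have xE : x = y + delta_mx 0 i.
    apply/rowP => j; rewrite !mxE eqxx /=; have [->|/[dup] ji /z0 ->] := eqVneq j i => //.
    by rewrite addr0.
  exists (y, i); split; first by rewrite /joins /endpoint1 /endpoint2 /= -xE !eqxx orbT.
  move=> [z j] /orP[]/andP[/eqP]; rewrite /endpoint1 /endpoint2 /= => -> /eqP.
    rewrite xE => /rowP/(_ i); rewrite !mxE !eqxx /=; lia.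
  rewrite xE => /addrI /rowP/(_ i); rewrite !mxE !eqxx /=.
  by case: eqVneq => // ->.
Qed.

(* [w e = true] means that the edge [e] is open. *)
Definition configuration := config edge.

Definition component (r : rel vertex) (x : vertex) : set vertex :=
  [set y | exists2 s, path r x s & last x s = y].

Definition open_adj (w : configuration) : rel vertex :=
  fun x y => `[< exists2 e, joins e x y & w e >].

Definition cluster (w : configuration) : vertex -> set vertex :=
  component (open_adj w).

Definition has_infinite_cluster : set configuration :=
  [set w | exists x, infinite_set (cluster w x)].

(* Infinite clusters are almost surely unique; for configurations with several
   of them, all of them are removed. *)
Definition X_vertex (w : configuration) : set vertex :=
  [set x | ~ infinite_set (cluster w x)].

(* The edges of X are all nearest-neighbor edges, open or closed, between two
   remaining vertices. *)
Definition X_adj (w : configuration) : rel vertex :=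
  fun x y => `[< [/\ neighbor x y, X_vertex w x & X_vertex w y] >].

Definition X_has_infinite_component : set configuration :=
  [set w | exists2 x, X_vertex w x & infinite_set (component (X_adj w) x)].

Definition shielded (w : configuration) (x : vertex) : Prop :=
  forall e, incident e x -> ~~ w e.

Definition has_infinite_shielded_path : set configuration :=
  [set w | exists v : nat -> vertex,
    [/\ injective v, forall n, neighbor (v n) (v n.+1) &
        forall n, shielded w (v n)]].

End percolation.

Definition bond_percolation (R : realType) (d : nat) (p : R) :
    probability (configuration d) R :=
  bernoulli_product (edge d) p.

Definition p_c (R : realType) (d : nat) : R :=
  inf [set p | 0 <= p <= 1 /\
    (0 < bond_percolation d p (@has_infinite_cluster d))%E].

Definition p_fin (R : realType) (d : nat) : R :=
  sup [set p | 0 <= p <= 1 /\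
    (0 < bond_percolation d p (@X_has_infinite_component d))%E].

Definition p_shield (R : realType) (d : nat) : R :=
  sup [set p | 0 <= p <= 1 /\
    (0 < bond_percolation d p (@has_infinite_shielded_path d))%E].

(* Main.v *)
Require Import Defs.
From mathcomp Require Import all_boot all_order all_algebra.
From mathcomp Require Import all_classical all_reals all_analysis.
From mathcomp Require Import measurable_realfun.
From mathcomp Require Import perm fingroup zify ring lra.

(** The inequality p_shield <= p_fin is deterministic: a shielded vertex is
    alone in its cluster, so it survives the removal of the infinite clusters,
    and an infinite shielded path lies in one component of what remains
    ([shielded_path_subset_X]).

    For p_c < p_shield, two explicit numbers p1 < p2 are exhibited such that
    there is an infinite cluster with positive probability at p1 and an
    infinite shielded path with positive probability at p2. Both facts follow
    from the second moment method applied to oriented paths, that is, to paths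
    that only use steps +e_i and are therefore coded by words in the d letters.

    Attach to a word a set of edges which must all be in the good state: the
    edges of the path, good meaning open; or the edges incident to the inner
    vertices of the path, good meaning closed. Let N be the number of good
    words of length n. Then E(N^2) / E(N)^2 is the average, over two
    independent uniform words, of r^(- number of shared edges), where r is the
    probability of the good state. Edges attached to different steps have
    different levels (sums of coordinates), so the shared edges are counted
    step by step, and at each step they depend only on the two letters and on
    the difference of the two positions. The average is bounded uniformly in n
    as soon as there is a function h >= 1 of the two positions whose weighted
    one-step average is at most h ([pair_sum_le]). Then N > 0 with probability
    at least 1 / h(0, 0) for every n, and continuity from above together with
    Koenig's lemma gives an infinite path.

    The function h is made from the Green function G of the difference of two
    independent oriented walks. Let t = 1/d. All that is needed about G is its
    equation ([fwd_bwd_green]), its symmetry ([green_root]) and the bound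
    G(0) <= 1 + t + 4 t^2 for d >= 10 ([green_le]), which follows from the fact
    that the probability of a return at time k is at most the maximum over x of
    the probability that one oriented walk is at x at time k: a multinomial
    probability, called [peak k].

    Put c = 1 / (1 - p). For open paths, h(x, y) = 1 + a G(x - y) works with a
    large as soon as c > 1 + t G(0) ([open_super]). For shielded paths the value
    of h on the diagonal has to be lowered to account for the 2d edges shared at
    a common vertex, and h exists as soon as a certain inequality between c, d
    and G(0) holds ([potential_params], [shield_super]). The values
    c1 = 1 + t + t^2 + 4.1 t^3 < c2 = 1 + t + t^2 + 4.2 t^3 both exceed
    1 + t G(0), and c2 still satisfies that inequality for every d >= 10
    ([shield_ineq]); at d = 10 and for the largest value that the
    bound on G(0) allows, its two sides are about 0.226 and 0.237. *)

Set Implicit Arguments.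
Unset Strict Implicit.
Unset Printing Implicit Defensive.

Import Order.TTheory GRing.Theory Num.Theory.
Import numFieldNormedType.Exports.

Local Open Scope classical_set_scope.
Local Open Scope ring_scope.

(** * Maximal multinomial probabilities *)

Section peak.
Variables (R : realType) (d : nat).
Hypothesis d_ge10 : (10 <= d)%N.

(** The maximum over x of the multinomial probability that k independent
    uniform draws in a set of d elements give the counts x. It is reached at
    balanced counts; passing from k to k + 1 draws increases a smallest count,
    which becomes k %/ d + 1. *)
Fixpoint peak (k : nat) : R :=
  if k is k'.+1 then peak k' * (k'.+1%:R / (d * (k' %/ d).+1)%:R) else 1.

Let d_gt0 : (0 < d)%N. Proof. exact: leq_trans d_ge10. Qed.

Lemma peak_ge0 k : 0 <= peak k.
Proof. by elim: k => [|k ih] //=; rewrite mulr_ge0// divr_ge0. Qed.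

Lemma peakS_le k : peak k.+1 <= peak k.
Proof.
rewrite /= ler_piMr ?peak_ge0// ler_pdivrMr ?ltr0n ?muln_gt0 ?d_gt0// mul1r ler_nat.
by rewrite mulnC ltn_ceil.
Qed.

Lemma peak_antitone m n : (m <= n)%N -> peak n <= peak m.
Proof.
move=> /subnK <-; elim: (n - m)%N => [//|k ih].
by rewrite addSn; apply: le_trans ih; exact: peakS_le.
Qed.

Lemma peakS_small k : (k < d)%N -> peak k.+1 = k.+1%:R * d%:R^-1 * peak k.
Proof. by move=> kd; rewrite /= divn_small// muln1 mulrC. Qed.

(** During the d draws which take every count from m to m + 1, the first five
    factors are at most (m d + d/2) / (d (m + 1)) and the others at most 1. The
    fifth power of the former bound beats m / (m + 2), which is chosen so that
    the product over m telescopes. *)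
Lemma peak_block m : (0 < m)%N ->
  peak (m.+1 * d) <= peak (m * d) * (m%:R / m.+2%:R).
Proof.
move=> m0; pose x : R := (2 * m%:R + 1) / (2 * m%:R + 2).
have m1 : 1 <= m%:R :> R by rewrite ler1n.
have x0 : 0 <= x by rewrite /x divr_ge0//; lra.
have step r : (r < 5)%N -> peak (m * d + r).+1 <= peak (m * d + r) * x.
  move=> r5; rewrite /=; apply: ler_wpM2l; first exact: peak_ge0.
  rewrite divnMDl// divn_small ?addn0; last by lia.
  have D0 : 0 < d%:R :> R by rewrite ltr0n.
  have rd : 2 * (r.+1)%:R <= d%:R :> R by rewrite -natrM ler_nat; lia.
  rewrite natrM ler_pdivrMr; last by rewrite mulr_gt0// ltr0n.
  rewrite /x mulrAC ler_pdivlMr; last by lra.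
  rewrite -natr1 natrD natrM; move: rd; rewrite -!natr1; nra.
have h r : (r <= 5)%N -> peak (m * d + r) <= peak (m * d) * x ^+ r.
  elim: r => [|r ih] r5; first by rewrite addn0 mulr1.
  rewrite addnS; apply: (le_trans (step _ r5)).
  rewrite exprSr mulrA; apply: ler_wpM2r => //; exact/ih/ltnW.
have := h 5%N isT => h5.
apply: (le_trans (peak_antitone _)) (le_trans h5 _).
  by rewrite mulSn; lia.
apply: ler_wpM2l; first exact: peak_ge0.
rewrite /x expr_div_n ler_pdivrMr; last by apply: exprn_gt0; lra.
rewrite mulrAC ler_pdivlMr ?ltr0n//.
have -> : m.+2%:R = m%:R + 2 :> R by rewrite -addn2 natrD.
move: m1; set y : R := m%:R => y1.
(* Shifting the variable to m - 1 >= 0 makes all coefficients positive. *)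
have [z zE] : exists z, y = z + 1 by exists (y - 1); rewrite subrK.
have z0 : 0 <= z by lra.
rewrite -subr_ge0 zE.
rewrite [X in 0 <= X](_ : _ = 16 * z ^+ 5 + 160 * z ^+ 4 + 600 * z ^+ 3 +
  1070 * z ^+ 2 + 911 * z + 295); last by ring.
have := exprn_ge0 2 z0; have := exprn_ge0 3 z0; have := exprn_ge0 4 z0.
have := exprn_ge0 5 z0; lra.
Qed.

Lemma peak_blocks m : peak (m.+1 * d) <= peak d * (2 / (m.+1%:R * m.+2%:R)).
Proof.
elim: m => [|m ih]; first by rewrite !mul1n mul1r divff ?mulr1 ?pnatr_eq0.
apply: le_trans (peak_block (ltn0Sn m)) _.
apply: le_trans (ler_wpM2r _ ih) _; first by rewrite divr_ge0.
rewrite le_eqVlt; apply/orP; left; apply/eqP; field.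
by rewrite -!natr1 !gt_eqF //; have : 0 <= m%:R :> R by []; lra.
Qed.

(** The sum of 2 / (m (m + 1)) telescopes: this is the only use of the decay of
    [peak] beyond time d. *)
Lemma sum_peak_blocks m :
  \sum_(0 <= k < m.+1 * d) peak k <=
  \sum_(0 <= k < 10) peak k + (d%:R - 10) * peak 10 +
  d%:R * peak d * (2 - 2 / m.+1%:R).
Proof.
have blk a n : \sum_(a <= k < a + n) peak k <= n%:R * peak a.
  elim: n => [|n ih]; first by rewrite addn0 big_geq// mul0r.
  rewrite addnS big_nat_recr ?leq_addr//= -natr1 mulrDl mul1r.
  by apply: lerD => //; apply: peak_antitone; rewrite leq_addr.
elim: m => [|m ih].
  rewrite mul1n divr1 subrr mulr0 addr0 (big_cat_nat (n := 10)) //= lerD2l.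
  by have := blk 10 (d - 10)%N; rewrite subnKC// natrB.
rewrite (big_cat_nat (n := m.+1 * d)) ?leq_mul2r ?leqnSn ?orbT//=.
rewrite [(m.+2 * d)%N]mulSn addnC.
apply: le_trans (lerD ih (blk _ _)) _.
rewrite -addrA lerD2l.
apply: le_trans (lerD (lexx _) (ler_wpM2l _ (peak_blocks m))) _ => //.
rewrite le_eqVlt; apply/orP; left; apply/eqP; field.
by rewrite -!natr1 !gt_eqF //; have : 0 <= m%:R :> R by []; lra.
Qed.

(** The terms 1 and 1/d are the contributions of times 0 and 1; the exact sum
    of all later ones is about 3.3 / d^2 when d = 10 and smaller multiples
    of 1/d^2 when d is larger. *)
Definition green_bound : R := 1 + d%:R^-1 + 4 * d%:R^-1 ^+ 2.

Lemma sum_peak_le n : \sum_(0 <= k < n) peak k <= green_bound.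
Proof.
apply: (@le_trans _ _ (\sum_(0 <= k < n.+1 * d) peak k)).
  rewrite [X in _ <= X](big_cat_nat (n := n))//=; last by rewrite -{1}(muln1 n) leq_mul.
  by rewrite lerDl sumr_ge0// => i _; exact: peak_ge0.
apply: (le_trans (sum_peak_blocks n)).
set t : R := d%:R^-1.
have t0 : 0 < t by rewrite invr_gt0 ltr0n.
have dt : d%:R * t = 1 by rewrite divff// pnatr_eq0 -lt0n.
have t10 : t <= 10^-1 by rewrite lef_pV2 ?posrE ?ltr0n// ler_nat.
apply: (@le_trans _ _ (\sum_(0 <= k < 10) peak k + (d%:R - 10) * peak 10 + d%:R * peak 10 * 2)).
  rewrite lerD2l; apply: ler_pM; rewrite ?mulr_ge0 ?peak_ge0//.
    rewrite subr_ge0 ler_pdivrMr ?ltr0n// ler_peMr// ler1n//.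
    by rewrite ler_wpM2l// peak_antitone.
  by rewrite gerBl divr_ge0.
do 10! rewrite big_ltn//; rewrite big_geq// addr0 /green_bound -/t.
have pS k : (k < 10)%N -> peak k.+1 = k.+1%:R * t * peak k.
  by move=> k10; rewrite peakS_small// (leq_trans k10).
have p0 : peak 0 = 1 by [].
rewrite !pS// p0.
have -> : d%:R = t^-1 by rewrite /t invrK.
(* In terms of u = 10/d <= 1 every term increases with u, so d = 10 is the worst
   case; the last one gathers the 3d - 10 times, with multiplicity, at which
   [peak] has been replaced by its value at 10. *)
pose u := 10 * t; have tE : t = u / 10 by rewrite /u; field.
have u0 : 0 < u by rewrite /u; lra.
have u1 : u <= 1 by rewrite /u; lra.
rewrite [X in X <= _](_ : _ = 1 + t + t ^+ 2 * (2 + 3/5 * u + 6/25 * u ^+ 2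
   + 3/25 * u ^+ 3 + 9/125 * u ^+ 4 + 63/1250 * u ^+ 5
   + 126/3125 * u ^+ 6 + 567/15625 * u ^+ 7
   + 1134/3125 * (u ^+ 6 * (u * (3 - u))))); last first.
  rewrite tE; field; lra.
rewrite lerD2l [4 * _]mulrC ler_pM2l ?exprn_gt0//.
have uk k : u ^+ k <= 1 by rewrite exprn_ile1// ltW.
have u6 : u ^+ 6 * (u * (3 - u)) <= 2.
  rewrite -[leRHS]mul1r; apply: ler_pM; rewrite ?exprn_ge0 ?mulr_ge0//; try lra; nra.
have := uk 2%N; have := uk 3%N; have := uk 4%N; have := uk 5%N.
have := uk 6%N; have := uk 7%N; lra.
Qed.
End peak.

(** * The Green function of the difference of two oriented walks *)

Section walk.
Variables (R : realType) (d : nat).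
Hypothesis d_ge10 : (10 <= d)%N.

Let d_gt0 : (0 < d)%N. Proof. exact: leq_trans d_ge10. Qed.
Let dR_gt0 : 0 < d%:R :> R. Proof. by rewrite ltr0n. Qed.

Definition unitv (i : 'I_d) : vertex d := delta_mx 0 i.

Definition avg (f : 'I_d -> R) : R := d%:R^-1 * \sum_i f i.

Lemma avg_cst a : avg (fun=> a) = a.
Proof. by rewrite /avg sumr_const card_ord -[a *+ d]mulr_natl mulrA mulVf ?mul1r// gt_eqF. Qed.

Lemma le_avg f g : (forall i, f i <= g i) -> avg f <= avg g.
Proof. by move=> fg; rewrite ler_pM2l ?invr_gt0// ler_sum. Qed.

Lemma eq_avg f g : f =1 g -> avg f = avg g.
Proof. by move=> fg; rewrite /avg (eq_bigr g). Qed.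

Lemma avgD f g : avg (fun i => f i + g i) = avg f + avg g.
Proof. by rewrite /avg big_split mulrDr. Qed.

Lemma avgZ a f : avg (fun i => a * f i) = a * avg f.
Proof. by rewrite /avg -mulr_sumr mulrCA. Qed.

Lemma avg_exchange (f : 'I_d -> 'I_d -> R) :
  avg (fun i => avg (f i)) = avg (fun j => avg (fun i => f i j)).
Proof. by rewrite /avg -!mulr_sumr exchange_big. Qed.

(** [fwd] and [bwd] are adjoint one-step averages of the oriented walk; the
    difference of two independent oriented walks has the transition operator
    [fwd \o bwd]. *)
Definition fwd (f : vertex d -> R) z := avg (fun i => f (z + unitv i)).
Definition bwd (f : vertex d -> R) z := avg (fun i => f (z - unitv i)).

Definition at_origin (z : vertex d) : R := (z == 0)%:R.

(** The law at time k of the oriented walk started at the origin. *)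
Definition walk_law k := iter k bwd at_origin.

(** By symmetry of the difference walk, [diff_law k z] is the probability to go
    from z to the origin in k steps. *)
Definition diff_law k := iter k (fwd \o bwd) at_origin.

Lemma fwdE f g : f =1 g -> fwd f =1 fwd g.
Proof. by move=> fg z; apply: eq_avg => i. Qed.
Lemma bwdE f g : f =1 g -> bwd f =1 bwd g.
Proof. by move=> fg z; apply: eq_avg => i. Qed.

Lemma fwd_bwdC f : fwd (bwd f) =1 bwd (fwd f).
Proof.
move=> z; rewrite /fwd /bwd avg_exchange; apply: eq_avg => i; apply: eq_avg => j.
by rewrite addrAC.
Qed.

Lemma fwd_le f a : (forall z, f z <= a) -> forall k z, iter k fwd f z <= a.
Proof.
move=> fa; elim=> [//|k ih] z; rewrite -[leRHS]avg_cst /= /fwd.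
by apply: le_avg => i.
Qed.

(** This turns a sum of squares of point probabilities into an average of point
    probabilities of a single walk, hence the supremum bound [diff_law_le]. *)
Lemma diff_lawE k : diff_law k =1 iter k fwd (walk_law k).
Proof.
have C n f : iter n fwd (bwd f) =1 bwd (iter n fwd f).
  elim: n f => [//|n ih] f z; rewrite /= (fwdE (ih f)).
  exact: fwd_bwdC.
elim: k => [//|k ih] z; rewrite /diff_law /= -/(diff_law k).
rewrite (fwdE (bwdE ih)).
by apply: fwdE => y; rewrite C.
Qed.

Lemma diff_law_ge0 k z : 0 <= diff_law k z.
Proof.
elim: k z => [|k ih] z; first by rewrite /diff_law/= ler0n.
by rewrite -(avg_cst 0) le_avg// => i; rewrite -(avg_cst 0) le_avg.
Qed.

(** In terms of multinomial coefficients this is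
    x_i (k+1; x) = (k+1) (k; x - e_i); it follows by induction from the
    one-step recursion alone, for all integer points x. *)
Lemma walk_law_coord k (x : vertex d) (i : 'I_d) :
  (x 0 i)%:~R * walk_law k.+1 x = k.+1%:R / d%:R * walk_law k (x - unitv i).
Proof.
have split n (y : vertex d) : (y 0 i)%:~R * walk_law n.+1 y =
    d%:R^-1 * (\sum_j ((y - unitv j) 0 i)%:~R * walk_law n (y - unitv j))
    + d%:R^-1 * walk_law n (y - unitv i).
  rewrite /walk_law /= /bwd /avg mulrCA -mulrDr; congr (_ * _).
  rewrite mulr_sumr (bigD1 i)//= [X in _ = X + _](bigD1 i)//= addrAC; congr (_ + _).
    by rewrite !mxE !eqxx /= rmorphB /= mulrBl mul1r subrK.
  apply: eq_bigr => j /negPf ji; rewrite !mxE eqxx/= eq_sym ji.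
  by rewrite subr0.
elim: k x => [|k ih] x.
  rewrite split big1 ?mulr0 ?add0r ?mul1r// => j _.
  rewrite /walk_law /= /at_origin; have [->|_] := eqVneq; first by rewrite mxE mul0r.
  by rewrite mulr0.
rewrite split (eq_bigr _ (fun j _ => ih (x - unitv j))) -mulr_sumr.
rewrite mulrCA -mulrA -[k.+2%:R]natr1 !mulrDl mul1r; congr (_ + _).
rewrite -!mulrA; congr (_ * (_ * _)).
rewrite {2}/walk_law /= /bwd /avg; congr (_ * _).
by apply: eq_bigr => j _; rewrite addrAC.
Qed.

Lemma walk_law_supp k x : walk_law k x != 0 -> \sum_i x 0 i = k%:Z.
Proof.
elim: k x => [|k ih] x.
  rewrite /walk_law /= /at_origin; have [-> _|_] := eqVneq x 0; last by rewrite eqxx.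
  by apply: big1 => i _; rewrite mxE.
rewrite -[walk_law _ _]/(bwd (walk_law k) x) => h.
have [j] : exists j, walk_law k (x - unitv j) != 0.
  apply/existsP; apply: contraNT h; rewrite negb_exists => /forallP h.
  rewrite -(avg_cst 0); apply/eqP/eq_avg => j.
  by apply/eqP; have := h j; rewrite negbK.
move/ih => E; rewrite -[k.+1]add1n PoszD -E.
rewrite (bigD1 j)//= [in RHS](bigD1 j)//= addrA; congr (_ + _).
  by rewrite !mxE !eqxx addrC subrK.
by apply: eq_bigr => i /negPf ij; rewrite !mxE eqxx ij subr0.
Qed.

(** Among k + 1 steps some letter i is used at least k %/ d + 1 times;
    [walk_law_coord] for that letter reproduces the recursion of [peak]. *)
Lemma walk_law_le k x : walk_law k x <= peak R d k.
Proof.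
elim: k x => [|k ih] x; first by rewrite /walk_law /= /at_origin; case: eqVneq.
have [->|/walk_law_supp sx] := eqVneq (walk_law k.+1 x) 0; first exact: peak_ge0.
have [i xi] : exists i, (k %/ d).+1%:Z <= x 0 i.
  apply/existsP; apply: contraT; rewrite negb_exists => /forallP h.
  have : \sum_(i < d) x 0 i <= \sum_(i < d) (k %/ d)%:Z.
    by apply: ler_sum => i _; have := h i; lia.
  rewrite sx sumr_const card_ord -mulr_natr natz -PoszM lez_nat ltnNge.
  by rewrite leq_divM.
have xi' : (k %/ d).+1%:R <= (x 0 i)%:~R :> R by rewrite -[leLHS]/((k %/ d).+1%:Z%:~R) ler_int.
have xi0 : 0 < (x 0 i)%:~R :> R by apply: lt_le_trans xi'; rewrite ltr0n.
rewrite -(ler_pM2l xi0) walk_law_coord.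
apply: (@le_trans _ _ ((k %/ d).+1%:R * peak R d k.+1)); last first.
  by rewrite ler_wpM2r// peak_ge0.
rewrite [leRHS](_ : _ = k.+1%:R / d%:R * peak R d k).
  by rewrite ler_wpM2l// divr_ge0.
by rewrite /= natrM; field; rewrite gt_eqF//= pnatr_eq0.
Qed.

Lemma diff_law_le k z : diff_law k z <= peak R d k.
Proof. by rewrite diff_lawE; exact/fwd_le/walk_law_le. Qed.

Definition green_upto n z := \sum_(0 <= k < n) diff_law k z.

Definition green z : R := limn (green_upto ^~ z).

Lemma green_upto_le n z : green_upto n z <= green_bound R d.
Proof.
apply: le_trans (sum_peak_le R d_ge10 n).
by apply: ler_sum => k _; exact: diff_law_le.
Qed.

Lemma cvg_green z : green_upto n z @[n --> \oo] --> green z.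
Proof.
apply: nondecreasing_is_cvgn.
  apply/nondecreasing_seqP => n.
  by rewrite /green_upto big_nat_recr//= lerDl diff_law_ge0.
by exists (green_bound R d) => _ [n _ <-]; exact: green_upto_le.
Qed.

Lemma green_le z : green z <= green_bound R d.
Proof.
apply: limr_le; first exact: cvgP (@cvg_green z).
by apply: nearW => n; exact: green_upto_le.
Qed.

Lemma green_ge0 z : 0 <= green z.
Proof.
apply: limr_ge; first exact: cvgP (@cvg_green z).
by apply: nearW => n; apply: sumr_ge0 => k _; exact: diff_law_ge0.
Qed.

Lemma cvg_avg (u : nat -> 'I_d -> R) (l : 'I_d -> R) :
  (forall i, u n i @[n --> \oo] --> l i) -> avg (u n) @[n --> \oo] --> avg l.
Proof.
move=> ul; apply: cvgMr; apply: cvg_big => //.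
by move=> *; exact: add_continuous.
Qed.

Lemma fwd_bwd_green z : fwd (bwd green) z = green z - at_origin z.
Proof.
have h1 : fwd (bwd (green_upto n)) z @[n --> \oo] --> fwd (bwd green) z.
  by apply: cvg_avg => i; apply: cvg_avg => j; exact: cvg_green.
have h2 : fwd (bwd (green_upto n)) z @[n --> \oo] --> green z - at_origin z.
  rewrite (_ : (fun n => _) = fun n => green_upto n.+1 z - at_origin z).
    apply: cvgB; last exact: cvg_cst.
    by have := @cvg_green z; rewrite -cvg_shiftS.
  apply/funext => n; rewrite /green_upto big_nat_recl//= addrC addKr.
  elim: n => [|n ih].
    rewrite big_geq//.
    transitivity (fwd (bwd (fun=> 0)) z).
      by apply/fwdE/bwdE => y; rewrite big_geq.
    by rewrite /fwd /bwd !avg_cst.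
  rewrite big_nat_recr//= -ih -avgD; apply: eq_avg => i.
  by rewrite -avgD; apply: eq_avg => j; rewrite big_nat_recr.
exact: cvg_unique h1 h2.
Qed.

(** A root vector e_a - e_b of the lattice A_(d-1) on which the difference of
    two oriented walks lives. *)
Definition root_vec a b : vertex d := unitv a - unitv b.

(** The d directions are exchangeable. *)
Lemma diff_law_perm (s : 'S_d) k z : diff_law k (col_perm s z) = diff_law k z.
Proof.
elim: k z => [|k ih] z.
  rewrite /diff_law/= /at_origin; congr (nat_of_bool _)%:R; apply/eqP/eqP => [h|->].
    by apply/rowP => i; have /rowP/(_ ((s^-1)%g i)) := h; rewrite !mxE permKV.
  by apply/rowP => i; rewrite !mxE.
have uE i : col_perm s (unitv (s i)) = unitv i.
  by apply/rowP => j; rewrite !mxE !eqxx/= (inj_eq perm_inj).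
have avgP f : avg (fun i => f (s i)) = avg f.
  by rewrite /avg [in RHS](reindex_inj (@perm_inj _ s)).
rewrite /diff_law /= -/(diff_law k) -[LHS]/(avg _) -[RHS]/(avg _) -[RHS]avgP.
apply: eq_avg => i; rewrite -[LHS]/(avg _) -[RHS]/(avg _) -[RHS]avgP.
apply: eq_avg => j; rewrite -[RHS]ih; congr diff_law.
by rewrite -(uE i) -(uE j); apply/rowP => l; rewrite !mxE.
Qed.

Lemma green_perm (s : 'S_d) z : green (col_perm s z) = green z.
Proof.
rewrite /green (_ : green_upto ^~ (col_perm s z) = green_upto ^~ z)//.
apply/funext => n; apply: eq_bigr => k _.
exact: diff_law_perm.
Qed.

(** Any two ordered pairs of distinct directions are exchanged by a
    permutation. *)
Lemma green_root a b a' b' : a != b -> a' != b' -> green (root_vec a b) = green (root_vec a' b').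
Proof.
have P (s : 'S_d) i j : green (root_vec (s i) (s j)) = green (root_vec i j).
  rewrite -(green_perm s); congr green.
  by apply/rowP => l; rewrite !mxE !eqxx/= !(inj_eq perm_inj).
move=> ab ab'; set b1 := tperm a a' b.
have b1a : b1 != a' by rewrite /b1 -{2}(tpermL a a') (inj_eq perm_inj) eq_sym.
rewrite -(P (tperm a a' * tperm b1 b')%g a b) !permM tpermL -/b1 tpermL.
by rewrite tpermD// eq_sym.
Qed.

End walk.

(** * The second moment method for oriented words *)

Section second_moment.
Context d (T : measurableType d) (R : realType) (P : probability T R).
Variables (J : choiceType) (s : seq J) (A : J -> set T).
Hypothesis mA : forall j, measurable (A j).

Let U := [set x | exists2 j, j \in s & A j x].

Lemma measurable_seq_union : measurable U.
Proof.
rewrite (_ : U = \big[setU/set0]_(j <- s) A j); first exact: bigsetU_measurable.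
by rewrite -bigcup_seq; apply/seteqP; split=> x [j js Ax]; exists j.
Qed.

(** The integral of 2 t N <= 1_(N > 0) + t^2 N^2, where N counts the events A_j
    that occur. Optimising in t gives the usual quotient E(N)^2 / E(N^2). *)
Lemma second_moment_bound (t : R) : 0 <= t ->
  ((2 * t)%:E * \sum_(j <- s) P (A j) <=
   P U + (t ^+ 2)%:E * \sum_(i <- s) \sum_(j <- s) P (A i `&` A j))%E.
Proof.
move=> t0; have mU := measurable_seq_union.
have mI i j : measurable (A i `&` A j) by exact: measurableI.
have Esum (K : choiceType) (r : seq K) (B : K -> set T) : (forall k, measurable (B k)) ->
    (\sum_(k <- r) P (B k) = \int[P]_x (\sum_(k <- r) (\1_(B k) x)%:E))%E.
  move=> mB; rewrite ge0_integral_sum//.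
  - by apply: eq_bigr => k _; rewrite integral_indic// setIT.
  - by move=> k; apply/measurable_EFinP; exact: measurable_indic.
have Emeas (K : choiceType) (r : seq K) (B : K -> set T) : (forall k, measurable (B k)) ->
    measurable_fun setT (fun x => \sum_(k <- r) (\1_(B k) x)%:E : \bar R)%E.
  move=> mB; apply: emeasurable_sum => k.
  by apply/measurable_EFinP; exact: measurable_indic.
have E0 (K : choiceType) (r : seq K) (B : K -> set T) x :
    (0 <= \sum_(k <- r) (\1_(B k) x)%:E :> \bar R)%E.
  by apply: sume_ge0 => k _; rewrite lee_fin.
pose B (ij : J * J) := A ij.1 `&` A ij.2.
have -> : (\sum_(i <- s) \sum_(j <- s) P (A i `&` A j) =
    \sum_(ij <- [seq (i, j) | i <- s, j <- s]) P (B ij))%E by rewrite big_allpairs.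
have mB ij : measurable (B ij) by exact: mI.
rewrite !Esum// -!ge0_integralZl//; try by [exact: Emeas|rewrite lee_fin ?mulr_ge0 ?exprn_ge0].
have -> : P U = (\int[P]_x (\1_U x)%:E)%E by rewrite integral_indic// setIT.
rewrite -ge0_integralD//; last 3 first.
- by apply/measurable_EFinP; exact: measurable_indic.
- by move=> x _; rewrite mule_ge0// lee_fin exprn_ge0.
- by apply: measurable_funeM; exact: (Emeas _ _ _ mB).
apply: ge0_le_integral => //;
  try by [move=> x _; rewrite ?adde_ge0// mule_ge0// lee_fin ?mulr_ge0 ?exprn_ge0].
- by apply: measurable_funeM; exact: (Emeas _ _ _ mA).
- apply: emeasurable_funD; first by apply/measurable_EFinP; exact: measurable_indic.
  by apply: measurable_funeM; exact: (Emeas _ _ _ mB).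
move=> x _.
rewrite !sumEFin -!EFinM -EFinD lee_fin big_allpairs.
rewrite [X in _ + _ * X](_ : _ = (\sum_(i <- s) \1_(A i) x) ^+ 2); last first.
  rewrite expr2 mulr_suml; apply: eq_bigr => i _.
  by rewrite mulr_sumr; apply: eq_bigr => j _; rewrite /B indicI.
have [Ux|Ux] := pselect (U x).
  rewrite indicE mem_set//= -exprMn; set N := \sum_(_ <- _) _.
  by rewrite -subr_ge0 [leRHS](_ : _ = (1 - t * N) ^+ 2) ?sqr_ge0//; ring.
rewrite big_seq big1 ?mulr0 ?addr_ge0 ?mulr_ge0 ?exprn_ge0//.
by move=> j js; rewrite indicE memNset// => Ax; apply: Ux; exists j.
Qed.
End second_moment.

Section measurable_configurations.
Variable I : countType.

Lemma measurable_edge (i : I) b : measurable [set w : config I | w i = b].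
Proof.
have m1 : measurable [set w : config I | w i] by apply: sub_sigma_algebra; exists i.
case: b => //; rewrite (_ : [set w | _] = ~` [set w : config I | w i]).
  exact: measurableC.
by apply/seteqP; split=> w /= => [->//|/negP/negbTE].
Qed.

Lemma measurable_all_edges (s : seq I) b :
  measurable [set w : config I | forall i, i \in s -> w i = b].
Proof.
elim: s => [|i s ih].
  by rewrite (_ : [set w | _] = setT) //; apply/seteqP; split.
rewrite (_ : [set w | _] = [set w : config I | w i = b] `&`
    [set w : config I | forall i, i \in s -> w i = b]).
  by apply: measurableI => //; exact: measurable_edge.
apply/seteqP; split=> w /= => [h|[wi h] j].
  by split=> [|j js]; apply: h; rewrite inE ?eqxx ?js ?orbT.
by rewrite inE => /orP[/eqP->|/h].
Qed.

Lemma prob_all_edges (R : realType) (p : R) (s : seq I) (b : bool) : 0 <= p <= 1 ->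
  bernoulli_product I p [set w | forall i, i \in s -> w i = b] =
  ((if b then p else 1 - p) ^+ size (undup s))%:E.
Proof.
move=> p01; have := bernoulli_productP p01 (fun=> b) (undup_uniq s).
rewrite big_const_seq count_predT iter_mulr mulr1 => <-; congr (bernoulli_product I p _).
by apply/seteqP; split=> w /= h i si; apply: h; move: si; rewrite mem_undup.
Qed.

End measurable_configurations.

Lemma size_undup_cat (T : eqType) (s t : seq T) : (forall x, x \in s -> x \notin t) ->
  size (undup (s ++ t)) = (size (undup s) + size (undup t))%N.
Proof.
move=> st; rewrite undup_cat size_cat; congr (size _ + _)%N.
by apply/all_filterP/allP => x; rewrite mem_undup; exact: st.
Qed.

Lemma eq_size_undup (T : eqType) (s t : seq T) : s =i t -> size (undup s) = size (undup t).
Proof. by move=> st; exact/perm_size/perm_undup. Qed.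

Section oriented_words.
Variables (R : realType) (d : nat).
Hypothesis d_gt0 : (0 < d)%N.

Fixpoint words n : seq (seq 'I_d) :=
  if n is n'.+1 then [seq i :: w | i <- enum 'I_d, w <- words n'] else [:: [::]].

Lemma mem_words n w : (w \in words n) = (size w == n).
Proof.
elim: n w => [|n ih] w; first by rewrite /= inE size_eq0.
case: w => [|i w] /=; first by apply/allpairsPdep => -[? [? []]].
rewrite eqSS -ih; apply/allpairsPdep/idP => [[j [v [_ vw [_ ->]]]]//|wn].
by exists i, w; rewrite mem_enum.
Qed.

Lemma sum_words n (f : seq 'I_d -> R) :
  \sum_(w <- words n.+1) f w = \sum_i \sum_(w <- words n) f (i :: w).
Proof. by rewrite big_allpairs_dep/= big_enum. Qed.

Definition level (x : vertex d) : int := \sum_i x 0 i.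

Lemma level_unitv x i : level (x + unitv i) = level x + 1.
Proof.
rewrite /level (bigD1 i)//= [in RHS](bigD1 i)//= !mxE !eqxx addrAC; congr (_ + _ + _).
by apply: eq_bigr => j /negPf ji; rewrite !mxE eqxx ji addr0.
Qed.

Variables (F : vertex d -> 'I_d -> seq (edge d)) (m : nat).
Hypothesis F_level : forall x i e, e \in F x i -> level e.1 = level x.
Hypothesis F_size : forall x i, size (undup (F x i)) = m.

Fixpoint word_edges (x : vertex d) (w : seq 'I_d) : seq (edge d) :=
  if w is i :: w' then F x i ++ word_edges (x + unitv i) w' else [::].

Lemma word_edges_level x w e : e \in word_edges x w -> level x <= level e.1.
Proof.
elim: w x => [//|i w ih] x /=; rewrite mem_cat => /orP[/F_level->//|/ih].
by apply: le_trans; rewrite level_unitv lerDl.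
Qed.

Lemma size_word_edges x w : size (undup (word_edges x w)) = (m * size w)%N.
Proof.
elim: w x => [|i w ih] x /=; first by rewrite muln0.
rewrite size_undup_cat ?F_size ?ih ?mulnS// => e /F_level ex.
by apply/negP => /word_edges_level; rewrite level_unitv ex gerDl.
Qed.

(** Edges attached to different steps lie at different levels, so only edges
    attached to simultaneous steps can coincide. *)
Lemma size_word_edges2 x y i j w v : level x = level y ->
  size (undup (word_edges x (i :: w) ++ word_edges y (j :: v))) =
  (size (undup (F x i ++ F y j)) +
   size (undup (word_edges (x + unitv i)%R w ++ word_edges (y + unitv j)%R v)))%N.
Proof.
move=> xy; rewrite -size_undup_cat; last first.
  move=> e; rewrite !mem_cat => /orP[] /F_level ex.
    by apply/negP => /orP[] /word_edges_level; rewrite level_unitv ex ?xy gerDl.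
  by apply/negP => /orP[] /word_edges_level; rewrite level_unitv ex ?xy gerDl.
apply: eq_size_undup => e; rewrite !mem_cat.
by case: (e \in F x i); case: (e \in F y j); rewrite ?orbT//= orbCA.
Qed.

Lemma word_edges_take x w k e : e \in word_edges x (take k w) -> e \in word_edges x w.
Proof.
elim: w x k => [//|i w ih] x [|k] //=; rewrite !mem_cat => /orP[->//|/ih ->].
by rewrite orbT.
Qed.

Variables (r : R) (h : vertex d -> vertex d -> R).
Hypothesis r_gt0 : 0 < r.
Hypothesis h_ge1 : forall x y, 1 <= h x y.
Hypothesis h_super : forall x y, level x = level y ->
  avg (fun i => avg (fun j =>
    r ^+ size (undup (F x i ++ F y j)) * h (x + unitv i) (y + unitv j))) <=
  r ^+ (2 * m) * h x y.

(** The expected number of good words of length n. *)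
Definition mean n := (d%:R * r ^+ m) ^+ n.

Lemma sum_mean n : \sum_(w <- words n) r ^+ (m * size w) = mean n.
Proof.
elim: n => [|n ih]; first by rewrite big_seq1 muln0.
rewrite sum_words; under eq_bigr => i _ do under eq_bigr => w _ do rewrite /= mulnS exprD.
under eq_bigr => i _ do rewrite -mulr_sumr ih.
by rewrite sumr_const card_ord -mulr_natl /mean exprS mulrA.
Qed.

(** The second moment, by induction on n: [h_super] says that the weighted
    average over the first letters of both words does not increase h. *)
Lemma pair_sum_le n x y : level x = level y ->
  \sum_(w <- words n) \sum_(v <- words n)
    r ^+ size (undup (word_edges x w ++ word_edges y v)) <= mean n ^+ 2 * h x y.
Proof.
have d0 : 0 < d%:R :> R by rewrite ltr0n.
elim: n x y => [|n ih] x y xy.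
  by rewrite /mean /= !big_seq1 expr0 expr1n mul1r.
rewrite sum_words; under eq_bigr => i _ do under eq_bigr => w _ do rewrite sum_words.
under eq_bigr => i _ do rewrite exchange_big/=.
apply: (@le_trans _ _ (\sum_i \sum_j mean n ^+ 2 *
   (r ^+ size (undup (F x i ++ F y j)) * h (x + unitv i) (y + unitv j)))).
  apply: ler_sum => i _; apply: ler_sum => j _.
  under eq_bigr => w _ do under eq_bigr => v _ do rewrite size_word_edges2// exprD.
  under eq_bigr => w _ do rewrite -mulr_sumr.
  rewrite -mulr_sumr mulrCA; apply: ler_wpM2l; first by rewrite exprn_ge0// ltW.
  by apply: ih; rewrite !level_unitv xy.
under eq_bigr => i _ do rewrite -mulr_sumr.
rewrite -mulr_sumr.
have -> : mean n.+1 ^+ 2 * h x y = mean n ^+ 2 * (d%:R ^+ 2 * (r ^+ (2 * m) * h x y)).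
  rewrite [mean n.+1]exprS -/(mean n) [(2 * m)%N]mulnC (exprM r m 2).
  by move: (r ^+ m) (mean n) => q M; ring.
apply: ler_wpM2l; first by rewrite exprn_ge0// exprn_ge0// mulr_ge0 ?exprn_ge0 ?ltW.
apply: le_trans (ler_wpM2l (ltW (exprn_gt0 2 d0)) (h_super xy)).
rewrite le_eqVlt; apply/orP; left; apply/eqP.
by rewrite /avg -mulr_sumr !mulrA expr2 mulfK ?gt_eqF// mulfV ?mul1r ?gt_eqF.
Qed.

Variables (p : R) (b : bool).
Hypothesis p01 : 0 <= p <= 1.
Hypothesis rE : r = if b then p else 1 - p.

Definition good_word (x : vertex d) (w : seq 'I_d) : set (configuration d) :=
  [set c | forall e, e \in word_edges x w -> c e = b].

Definition has_good_word x n : set (configuration d) :=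
  [set c | exists2 w, w \in words n & good_word x w c].

Lemma measurable_good_word x w : measurable (good_word x w).
Proof. exact: measurable_all_edges. Qed.

Lemma prob_has_good_word x n :
  (((h x x)^-1)%:E <= bond_percolation d p (has_good_word x n))%E.
Proof.
have d0 : 0 < d%:R :> R by rewrite ltr0n.
have h0 : 0 < h x x by apply: lt_le_trans (h_ge1 x x).
have M0 : 0 < mean n by rewrite exprn_gt0// mulr_gt0// exprn_gt0.
(* The parameter of [second_moment_bound] which is optimal when the second moment
   equals mean^2 * h. *)
have t0 : 0 <= (mean n * h x x)^-1 by rewrite invr_ge0 ltW// mulr_gt0.
have := second_moment_bound (bond_percolation d p) (words n) (measurable_good_word x) t0.
have pE w : bond_percolation d p (good_word x w) =
    (r ^+ size (undup (word_edges x w)))%:E.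
  by rewrite rE; exact: prob_all_edges.
have -> : (\sum_(w <- words n) bond_percolation d p (good_word x w) = (mean n)%:E)%E.
  under eq_bigr => w _ do rewrite pE size_word_edges.
  by rewrite sumEFin sum_mean.
have p2E w v : bond_percolation d p (good_word x w `&` good_word x v) =
    (r ^+ size (undup (word_edges x w ++ word_edges x v)))%:E.
  rewrite rE -prob_all_edges//; congr (bernoulli_product _ _ _).
  apply/seteqP; split=> c /=.
    by move=> [cw cv] e; rewrite mem_cat => /orP[/cw|/cv].
  by move=> cwv; split=> e ew; apply: cwv; rewrite mem_cat ew ?orbT.
have -> : (\sum_(w <- words n) \sum_(v <- words n)
      bond_percolation d p (good_word x w `&` good_word x v) =
    (\sum_(w <- words n) \sum_(v <- words n)
      r ^+ size (undup (word_edges x w ++ word_edges x v)))%:E)%E.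
  rewrite -sumEFin; apply: eq_bigr => w _; rewrite -sumEFin.
  by apply: eq_bigr => v _; exact: p2E.
set U := [set c | _]; have mU : measurable U by exact: measurable_seq_union (measurable_good_word x).
have -> : has_good_word x n = U by [].
rewrite -(@fineK _ (bond_percolation d p U)) ?fin_num_measure// -!EFinM -EFinD !lee_fin.
set u := fine _.
have := pair_sum_le n (erefl (level x)); set S := \sum_(_ <- _) _ => SE tS.
have : (mean n * h x x)^-1 ^+ 2 * S <= (h x x)^-1.
  apply: (@le_trans _ _ ((mean n * h x x)^-1 ^+ 2 * (mean n ^+ 2 * h x x))).
    by apply: ler_wpM2l => //; rewrite exprn_ge0.
  rewrite le_eqVlt; apply/orP; left; apply/eqP; field.
  by rewrite !gt_eqF.
have : 2 * (mean n * h x x)^-1 * mean n = 2 * (h x x)^-1 by field; rewrite !gt_eqF.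
lra.
Qed.

Lemma has_good_word_nonincreasing x k n : (k <= n)%N -> has_good_word x n `<=` has_good_word x k.
Proof.
move=> kn c [w]; rewrite mem_words => /eqP wn cw; exists (take k w).
  by rewrite mem_words size_takel// wn.
by move=> e /word_edges_take/cw.
Qed.

(** The bound 1 / h(x, x) does not depend on n and the events decrease. *)
Lemma prob_good_words_of_all_sizes x :
  (0 < bond_percolation d p (\bigcap_n has_good_word x n))%E.
Proof.
have mU n : measurable (has_good_word x n) by exact: measurable_seq_union (measurable_good_word x).
have mI : measurable (\bigcap_n has_good_word x n) by exact: bigcap_measurable.
have h0 : 0 < h x x by apply: lt_le_trans (h_ge1 x x).
apply: (@lt_le_trans _ _ ((h x x)^-1)%:E); first by rewrite lte_fin invr_gt0.
have := @nonincreasing_cvg_mu _ _ _ (bond_percolation d p) (has_good_word x).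
move=> /(_ _ mU mI) cv.
have {}cv := cv (le_lt_trans (probability_le1 _ (mU 0%N)) (ltry _)).
have {}cv : (bond_percolation d p \o has_good_word x) n @[n --> \oo] -->
    bond_percolation d p (\bigcap_n has_good_word x n).
  by apply: cv => k n kn; apply/subsetPset; exact: has_good_word_nonincreasing.
rewrite -(cvg_lim _ cv)//; apply: lime_ge; first exact: cvgP cv.
by apply: nearW => n; exact: prob_has_good_word.
Qed.

End oriented_words.

(** * The numerical inequality behind shielded paths *)

Section numeric.
Variable R : realType.

(** Through 1 + x <= exp x and exp (- s/m) >= 1 - s/m, this bounds a power with
    a variable exponent by one with a numerical exponent. *)
Lemma exprn_1D_le (x s : R) n m : 0 <= x -> n%:R * x <= s -> s < m%:R ->
  (1 + x) ^+ n <= (1 - s / m%:R) ^- m.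
Proof.
move=> x0 nxs sm.
have s0 : 0 <= s by apply: le_trans nxs; rewrite mulr_ge0.
have m0 : 0 < m%:R :> R by exact: le_lt_trans sm.
have sm0 : 0 < 1 - s / m%:R by rewrite subr_gt0 ltr_pdivrMr// mul1r.
apply: (@le_trans _ _ (expR s)).
  apply: (@le_trans _ _ (expR x ^+ n)).
    by rewrite lerXn2r ?nnegrE ?expR_ge0 ?addr_ge0// expR_ge1Dx.
  by rewrite -expRM_natl ler_expR.
pose u := s / m%:R; rewrite -/u in sm0 *.
have -> : s = m%:R * u by rewrite /u mulrC divfK// gt_eqF.
rewrite expRM_natl -exprVn lerXn2r ?nnegrE ?expR_ge0 ?invr_ge0 ?(ltW sm0)//.
rewrite -[u]opprK expRN lef_pV2 ?posrE ?expR_gt0 ?opprK//.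
exact: expR_ge1Dx.
Qed.

Lemma sqr_le (x a b : R) k : 0 <= x -> x ^+ k <= a -> a * a <= b -> x ^+ (k + k) <= b.
Proof.
move=> x0 xa ab; rewrite exprD; apply: le_trans ab.
by apply: ler_pM => //; exact: exprn_ge0.
Qed.

Lemma mulx_le (x y a b : R) k : 0 <= x <= y -> x ^+ k <= a -> y * a <= b -> x ^+ k.+1 <= b.
Proof.
move=> /andP[x0 xy] xa ab; rewrite exprS; apply: le_trans ab.
by apply: ler_pM => //; exact: exprn_ge0.
Qed.

(** The fractions have small terms and are rounded upwards at each step; 39/35
    is just above 1.1142, the value of [shield_c] at 1/10. *)
Lemma pow20_le (c : R) : 0 <= c <= 39 / 35 -> c ^+ 20 <= 877 / 100.
Proof.
move=> c0; have [c00 cu] := andP c0.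
have c2 : c ^+ 2 <= 77 / 62 by apply: (@sqr_le _ _ _ 1 c00 cu); lra.
have c4 : c ^+ 4 <= 54 / 35 by apply: (@sqr_le _ _ _ 2 c00 c2); lra.
have c5 : c ^+ 5 <= 43 / 25 by apply: (@mulx_le _ _ _ _ 4 c0 c4); lra.
have c10 : c ^+ 10 <= 74 / 25 by apply: (@sqr_le _ _ _ 5 c00 c5); lra.
by apply: (@sqr_le _ _ _ 10 c00 c10); lra.
Qed.

(** Here 43/39 is just above the value of [shield_c] at 1/11. *)
Lemma pow22_le (c : R) : 0 <= c <= 43 / 39 -> c ^+ 22 <= 26 / 3.
Proof.
move=> c0; have [c00 cu] := andP c0.
have c2 : c ^+ 2 <= 62 / 51 by apply: (@sqr_le _ _ _ 1 c00 cu); lra.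
have c4 : c ^+ 4 <= 34 / 23 by apply: (@sqr_le _ _ _ 2 c00 c2); lra.
have c5 : c ^+ 5 <= 31 / 19 by apply: (@mulx_le _ _ _ _ 4 c0 c4); lra.
have c10 : c ^+ 10 <= 8 / 3 by apply: (@sqr_le _ _ _ 5 c00 c5); lra.
have c11 : c ^+ 11 <= 50 / 17 by apply: (@mulx_le _ _ _ _ 10 c0 c10); lra.
by apply: (@sqr_le _ _ _ 11 c00 c11); lra.
Qed.

Lemma pow32_le (x : R) : 40 / 43 <= x -> x ^- 32 <= 31 / 3.
Proof.
move=> x1; rewrite -[leRHS]invrK lef_pV2 ?posrE ?invr_gt0 ?exprn_gt0//; try lra.
have sq y z k : 0 <= y -> y <= x ^+ k -> z <= y * y -> z <= x ^+ (k + k).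
  by move=> y0 yx /le_trans; apply; rewrite exprD; apply: ler_pM.
have x2 : 32 / 37 <= x ^+ 2 by apply: (sq (40 / 43) _ 1%N _ x1); lra.
have x4 : 74 / 99 <= x ^+ 4 by apply: (sq _ _ 2%N _ x2); lra.
have x8 : 24 / 43 <= x ^+ 8 by apply: (sq _ _ 4%N _ x4); lra.
have x16 : 19 / 61 <= x ^+ 16 by apply: (sq _ _ 8%N _ x8); lra.
by apply: (sq _ _ 16%N _ x16); lra.
Qed.

Lemma shield_final10 (t : R) : t = 10^-1 -> 877 / 100 * (3 * t ^+ 2 - 4 * t ^+ 3) <
  10 / 47 * (1 + t + t ^+ 2 - (1 + t + 37 / 5 * t ^+ 2) * (3 * t ^+ 2 - 4 * t ^+ 3)).
Proof. by move=> ->; lra. Qed.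

Lemma shield_final11 (t : R) : t = 11^-1 -> 26 / 3 * (3 * t ^+ 2 - 4 * t ^+ 3) <
  1 / 4 * (1 + t + t ^+ 2 - (1 + t + 37 / 5 * t ^+ 2) * (3 * t ^+ 2 - 4 * t ^+ 3)).
Proof. by move=> ->; lra. Qed.

Lemma shield_final12 (t : R) : 0 < t -> t <= 12^-1 ->
  31 / 3 * (3 * t ^+ 2 - 4 * t ^+ 3) <
  1 / 5 * (1 + t + t ^+ 2 - (1 + t + 37 / 5 * t ^+ 2) * (3 * t ^+ 2 - 4 * t ^+ 3)).
Proof.
move=> t0 t12; have rE : 3 * t ^+ 2 - 4 * t ^+ 3 = t * (t * (3 - 4 * t)) by ring.
set r := 3 * t ^+ 2 - _ in rE *.
have r1 : t * (3 - 4 * t) <= 2223 / 100 / 100 by nra.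
have r0 : 0 <= t * (3 - 4 * t) by nra.
have rle : r <= 186 / 100 / 100 by rewrite rE; nra.
have r0' : 0 <= r by rewrite rE; nra.
have k : 1 + t + 37 / 5 * t ^+ 2 <= 114 / 100 by rewrite expr2; nra.
have : (1 + t + 37 / 5 * t ^+ 2) * r <= 114 / 100 * r by apply: ler_wpM2r.
have : 0 <= t ^+ 2 by apply: exprn_ge0; exact: ltW.
lra.
Qed.

(** The value of 1 / (1 - p) at which shielded paths are shown to exist. *)
Definition shield_c (t : R) := 1 + t + t ^+ 2 + 21 / 5 * t ^+ 3.

(** The condition under which [potential_params] applies. With r expressed
    through G it is an affine inequality in G whose worst case is the largest
    possible value G = [green_bound]. For d = 10 and d = 11 the powers of c are
    bounded numerically; from d = 12 on a uniform bound of c^(2d) is enough. *)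
Lemma shield_ineq d (G : R) (t := d%:R^-1) (c := shield_c t)
    (r := (1 - t) * G - 1) : (10 <= d)%N ->
  G <= green_bound R d -> 0 <= r ->
  0 < 1 - t * c ^+ (2 * d).-1 /\
  c ^+ (2 * d) * r < (1 - t * c ^+ (2 * d).-1) * (G - 2 * d%:R * (c - 1) * r).
Proof.
move=> d10 Gle r0.
have d0 : 0 < d%:R :> R by rewrite ltr0n; lia.
have dt : d%:R * t = 1 by rewrite divff// gt_eqF.
have t0 : 0 < t by rewrite invr_gt0.
have c1t : 1 + t <= c.
  rewrite /c /shield_c -addrA lerDl addr_ge0 ?mulr_ge0 ?exprn_ge0 ?(ltW t0)//; lra.
have c0 : 0 < c by lra.
have rle : r <= 3 * t ^+ 2 - 4 * t ^+ 3.
  move: Gle; rewrite /green_bound -/t => Gle.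
  have t10 : t <= 10^-1 by rewrite lef_pV2 ?posrE// ler_nat.
  have : (1 - t) * G <= (1 - t) * (1 + t + 4 * t ^+ 2) by apply: ler_wpM2l; lra.
  rewrite /r; set v := _ * G; lra.
have Yc : c ^+ (2 * d) = c * c ^+ (2 * d).-1 by rewrite -exprS prednK// muln_gt0/=; lia.
have dc : 2 * d%:R * (c - 1) = 2 * (1 + t + 21 / 5 * t ^+ 2).
  transitivity (2 * (d%:R * t) * (1 + t + 21 / 5 * t ^+ 2)); last by rewrite dt mulr1.
  by rewrite /c /shield_c; ring.
(* G = (1 + r) / (1 - t). *)
have Gge : (1 + r) * (1 + t + t ^+ 2) <= G.
  have t1 : t < 1 by rewrite -dt ltr_pMl// ltr1n; lia.
  have -> : 1 + r = (1 - t) * G by rewrite /r; ring.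
  rewrite mulrAC [X in X * _](_ : _ = 1 - t ^+ 3); last by ring.
  have G0 : 0 <= G by rewrite -(pmulr_rge0 _ (_ : 0 < 1 - t)) ?subr_gt0// -(subrK 1 (_ * _)) addr_ge0.
  rewrite ler_piMl// gerBl exprn_ge0// ltW//.
rewrite dc.
set Z := c ^+ (2 * d).-1 in Yc *.
have Z0 : 0 < Z by exact: exprn_gt0.
suff [Y [D [YE DE D0 fin]]] : exists Y D, [/\ c ^+ (2 * d) <= Y, t * Z <= 1 - D, 0 < D &
   Y * (3 * t ^+ 2 - 4 * t ^+ 3) < D * (1 + t + t ^+ 2 - (1 + t + 37/5 * t ^+ 2) * (3 * t ^+ 2 - 4 * t ^+ 3))].
  split; first by apply: lt_le_trans D0 _; lra.
  apply: (@le_lt_trans _ _ (Y * (3 * t ^+ 2 - 4 * t ^+ 3))).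
    by apply: ler_pM => //; rewrite exprn_ge0// ltW.
  apply: (lt_le_trans fin).
  have k0 : 0 <= 1 + t + 37 / 5 * t ^+ 2 by rewrite addr_ge0 ?mulr_ge0 ?exprn_ge0 ?(ltW t0)//; lra.
  set w := 1 + t + t ^+ 2 - _.
  have wle : w <= G - 2 * (1 + t + 21 / 5 * t ^+ 2) * r.
    have : (1 + t + 37 / 5 * t ^+ 2) * r <= (1 + t + 37 / 5 * t ^+ 2) * (3 * t ^+ 2 - 4 * t ^+ 3).
      exact: ler_wpM2l.
    rewrite /w; move: Gge; set u := _ * (3 * _ - _); lra.
  apply: ler_pM => //; [exact: ltW| |lra].
  have : 0 < D * w.
    apply: le_lt_trans fin; apply: mulr_ge0; last exact: le_trans r0 rle.
    by apply: le_trans YE; rewrite exprn_ge0// ltW.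
  by rewrite pmulr_rgt0// => /ltW.
have DE Y D : c ^+ (2 * d) <= Y -> t * Y <= (1 - D) * c -> t * Z <= 1 - D.
  move=> YE tY; rewrite -(ler_pM2r c0); apply: le_trans tY.
  by rewrite -mulrA [Z * c]mulrC -Yc ler_pM2l.
have [dE|dE|d12] : [\/ d = 10%N, d = 11%N | (12 <= d)%N].
  by case: (ltngtP d 11) => [d11|d11|->]; [apply: Or31|apply: Or33|apply: Or32] => //; lia.
- have tE : t = 10^-1 by rewrite /t dE.
  have cE : (2 * 557 + 2 / 10) / 1000 = c by rewrite /c /shield_c tE; field.
  clearbody t c Z; clear r0 rle Gge Gle dc dt.
  exists (877 / 100), (10 / 47); split => //; last exact: shield_final10.
  + by rewrite dE; apply: pow20_le; rewrite ltW//= -cE; clear; lra.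
  + apply: (DE (877 / 100)); first by rewrite dE; apply: pow20_le; rewrite ltW//= -cE; clear; lra.
    by rewrite tE -cE; clear; lra.
- have tE : t = 11^-1 by rewrite /t dE.
  have cE : 11 / 10 <= c <= 43 / 39.
    rewrite [c](_ : _ = (2 * 3668) / (5 * 1331)); last by rewrite /c /shield_c tE; field.
    by clear; apply/andP; split; lra.
  clearbody t c Z; clear r0 rle Gge Gle dc dt.
  exists (26 / 3), (1 / 4); split => //; last exact: shield_final11.
  + by rewrite dE; apply: pow22_le; clear - cE; lra.
  + apply: (DE (26 / 3)); first by rewrite dE; apply: pow22_le; clear - cE; lra.
    by rewrite tE; clear - cE; lra.
- have t12 : t <= 12^-1 by rewrite lef_pV2 ?posrE// ler_nat.
  have YE : c ^+ (2 * d) <= 31 / 3.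
    rewrite (_ : c = 1 + (c - 1)); last by ring.
    apply: (@le_trans _ _ ((1 - (89 / 40) / 32%:R) ^- 32)).
      clear DE Z Z0 Yc Gge Gle r0 rle.
      apply: exprn_1D_le; [lra| |lra].
      rewrite natrM dc expr2; clearbody c t; nra.
    by apply: pow32_le; clear; lra.
  exists (31 / 3), (1 / 5); split => //; last exact: shield_final12.
  apply: (DE _ _ YE).
  clear - c1t t0 t12; clearbody c t; nra.
Qed.
End numeric.

(** * Weights and superharmonic functions for open and for shielded words *)

Section supersolutions.
Variables (R : realType) (d : nat).
Hypothesis d_ge10 : (10 <= d)%N.

Let d_gt0 : (0 < d)%N. Proof. exact: leq_trans d_ge10. Qed.
Let dR_gt0 : 0 < d%:R :> R. Proof. by rewrite ltr0n. Qed.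

Local Notation t := (d%:R^-1 : R).
Local Notation G := (@green R d).
Local Notation e_ := (@unitv d).

Lemma avg_delta (a : 'I_d) : avg (fun i => (i == a)%:R) = t.
Proof. by rewrite /avg (bigD1 a)//= eqxx big1 ?addr0 ?mulr1// => i /negPf ->. Qed.

Lemma avg_prod (f g : 'I_d -> R) : avg (fun i => avg (fun j => f i * g j)) = avg f * avg g.
Proof. by under eq_avg => i do rewrite avgZ mulrC; rewrite avgZ mulrC. Qed.

Lemma avg2D (f g : 'I_d -> 'I_d -> R) : avg (fun i => avg (fun j => f i j + g i j)) =
  avg (fun i => avg (f i)) + avg (fun i => avg (g i)).
Proof. by rewrite -avgD; apply: eq_avg => i; rewrite avgD. Qed.

Lemma avg2Z a (f : 'I_d -> 'I_d -> R) : avg (fun i => avg (fun j => a * f i j)) =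
  a * avg (fun i => avg (f i)).
Proof. by rewrite -avgZ; apply: eq_avg => i; rewrite avgZ. Qed.

Lemma eq_avg2 (f g : 'I_d -> 'I_d -> R) : (forall i j, f i j = g i j) ->
  avg (fun i => avg (f i)) = avg (fun i => avg (g i)).
Proof. by move=> fg; apply: eq_avg => i; apply: eq_avg => j. Qed.

Lemma le_avg2 (f g : 'I_d -> 'I_d -> R) : (forall i j, f i j <= g i j) ->
  avg (fun i => avg (f i)) <= avg (fun i => avg (g i)).
Proof. by move=> fg; apply: le_avg => // i; apply: le_avg. Qed.

Lemma avg2_diag : avg (fun i : 'I_d => avg (fun j => (j == i)%:R)) = t.
Proof. by under eq_avg => i do rewrite avg_delta; rewrite avg_cst. Qed.

Lemma avg2_green (a : R) z : avg (fun i => avg (fun j => 1 + a * G (z + e_ i - e_ j))) =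
  1 + a * (G z - at_origin R z).
Proof. by rewrite avg2D avg2Z !avg_cst// -fwd_bwd_green. Qed.

(** The equation of the Green function at the origin, where the difference walk
    stays with probability 1/d and otherwise jumps to a root vector. *)
Lemma green_root_vec a b : a != b -> (1 - t) * G (root_vec a b) = (1 - t) * G 0 - 1.
Proof.
move=> ab; have := @fwd_bwd_green R d d_ge10 0; rewrite /at_origin eqxx.
rewrite /fwd /bwd (eq_avg2 (g := fun i j => G (root_vec a b) + (G 0 - G (root_vec a b)) * (j == i)%:R)).
  by rewrite avg2D avg2Z avg2_diag !avg_cst//= => h; lra.
move=> i j; have [->|ji] := eqVneq j i; first by rewrite add0r subrr /=; ring.
by rewrite add0r mulr0 addr0; apply: green_root => //; rewrite eq_sym.
Qed.

(** Open words: each step requires its own edge to be open. *)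
Definition open_step (x : vertex d) (i : 'I_d) : seq (edge d) := [:: (x, i)].

(** Two words share the edge of a step exactly when they are at the same vertex
    and use the same letter. This extra weight only appears on the diagonal,
    where it is paid for by the source term of the Green function. *)
Lemma open_super (p a : R) : 0 < p -> p <= 1 ->
  (1 - p) / (p * d%:R) * (1 + a * G 0) <= a -> forall x y : vertex d,
  avg (fun i => avg (fun j => p ^+ size (undup (open_step x i ++ open_step y j)) *
    (1 + a * G (x + e_ i - (y + e_ j))))) <= p ^+ (2 * 1) * (1 + a * G (x - y)).
Proof.
move=> p0 p1 ha x y.
have zE (u v : vertex d) i j : u + e_ i - (v + e_ j) = (u - v) + e_ i - e_ j.
  by rewrite opprD addrACA addrA.
have [->|xy] := eqVneq x y.
  rewrite (eq_avg2 (g := fun i j => p ^+ 2 * (1 + a * G (0 + e_ i - e_ j)) +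
     (p - p ^+ 2) * (1 + a * G 0) * (j == i)%:R)).
    rewrite avg2D !avg2Z avg2_green avg2_diag /at_origin eqxx subrr muln1.
    have : p ^+ 2 * ((1 - p) / (p * d%:R) * (1 + a * G 0)) <= p ^+ 2 * a.
      by rewrite ler_pM2l// exprn_gt0.
    rewrite [p ^+ 2 * (_ / _ * _)](_ : _ = (p - p ^+ 2) * (1 + a * G 0) * t); last first.
      by field; rewrite !gt_eqF.
    by move=> ? /=; lra.
  move=> i j; rewrite zE subrr.
  rewrite /= inE xpair_eqE eqxx/= [i == j]eq_sym; have [->|ji] := eqVneq j i.
    by rewrite add0r subrr /=; ring.
  by rewrite mulr0 addr0.
rewrite (eq_avg2 (g := fun i j => p ^+ 2 * (1 + a * G ((x - y) + e_ i - e_ j)))).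
  rewrite avg2Z avg2_green /at_origin subr_eq0 (negPf xy) subr0//.
by move=> i j; rewrite zE /= inE xpair_eqE (negPf xy).
Qed.

(** Shielded words: a step from x to x + e_i requires all upward edges of x and
    all downward edges of x + e_i to be closed. These 2d - 1 edges join the
    levels of x and x + e_i; over a whole word they make up all the edges
    incident to the inner vertices of its path. *)
Definition shield_step (x : vertex d) (i : 'I_d) : seq (edge d) :=
  [seq (x, k) | k <- enum 'I_d] ++
  [seq (x + e_ i - e_ k, k) | k <- enum 'I_d & k != i].

Lemma mem_shield_step x i v k : ((v, k) \in shield_step x i) =
  (v == x) || (k != i) && (v == x + e_ i - e_ k).
Proof.
rewrite mem_cat; congr orb.
  apply/mapP/eqP => [[l _ [-> _]]//|->]; by exists k; rewrite ?mem_enum.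
apply/mapP/andP => [[l]|[ki /eqP->]].
  by rewrite mem_filter => /andP[li _] [-> ->].
by exists k; rewrite // mem_filter ki mem_enum.
Qed.

Lemma unitv_inj : injective e_.
Proof. by move=> i j /rowP/(_ i); rewrite !mxE !eqxx/=; case: eqVneq. Qed.

Lemma size_enum_neq (i : 'I_d) : size [seq k <- enum 'I_d | k != i] = d.-1.
Proof.
have := count_predC (pred1 i) (enum 'I_d).
rewrite size_enum_ord count_uniq_mem ?enum_uniq// mem_enum/= add1n => h.
by rewrite size_filter -[in RHS]h.
Qed.

Lemma shield_step_uniq x i : uniq (shield_step x i).
Proof.
rewrite cat_uniq; apply/and3P; split.
- by rewrite map_inj_uniq ?enum_uniq// => k l [].
- apply/hasPn => -[v k] /mapP[l]; rewrite mem_filter => /andP[li _] [-> ->].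
  apply/mapP => -[k' _ [h _]]; move: h li => /eqP.
  by rewrite -[X in _ == X]addr0 -addrA (inj_eq (addrI _)) subr_eq0 (inj_eq unitv_inj) eq_sym => ->.
- by rewrite map_inj_uniq => [|k l [_ ->]//]; exact/filter_uniq/enum_uniq.
Qed.

Lemma shield_step_size x i : size (shield_step x i) = (2 * d).-1.
Proof.
rewrite size_cat (size_map (fun k => (x, k))) (size_map _ [seq _ <- _ | _]) size_enum_neq size_enum_ord; lia.
Qed.

Lemma shield_step_level x i e : e \in shield_step x i -> level e.1 = level x.
Proof.
case: e => v k; rewrite mem_shield_step => /orP[/eqP->//|/andP[_ /eqP->]] /=.
by apply: (addIr 1); rewrite -(level_unitv _ k) subrK level_unitv.
Qed.

Lemma count_le_exists (P : pred 'I_d) s : uniq s -> (forall k l, P k -> P l -> k = l) ->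
  (count P s <= [exists k, P k])%N.
Proof.
move=> us PP; case: existsP => [[k Pk]|nP].
  apply: (@leq_trans (count_mem k s)); last by rewrite count_uniq_mem ?leq_b1.
  by apply: sub_count => l Pl; rewrite /= (PP _ _ Pl Pk).
by rewrite (@eq_count _ P pred0) ?count_pred0// => k; apply/negP => Pk; apply: nP; exists k.
Qed.

Definition below (x z : vertex d) := [exists k, x + e_ k == z].

(** Bounds the number of edges shared by two shielded steps. Besides the edges at a common starting or end point, the only
    possible coincidences are the edge from x to the end point of the other
    step and the edge from y to the end point of the first. *)
Definition overlap (x y : vertex d) (i j : 'I_d) : nat :=
  if x == y then (if i == j then (2 * d).-1 else d)
  else if x + e_ i == y + e_ j then d
  else (below x (y + e_ j)%R + below y (x + e_ i)%R)%N.

Lemma shield_step_overlap x y i j :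
  (count (mem (shield_step y j)) (shield_step x i) <= overlap x y i j)%N.
Proof.
have inj (z z' : vertex d) k l : z + e_ k == z' -> z + e_ l == z' -> k = l.
  by move=> /eqP <- /eqP/addrI/unitv_inj.
have sizeE : size (enum 'I_d) = d by exact: size_enum_ord.
rewrite /overlap count_cat (count_map (fun k => (x, k))).
rewrite (count_map (fun k => (x + e_ i - e_ k, k))).
have [->|xy] := eqVneq x y.
  have [->|ij] := eqVneq i j.
    apply: leq_trans (leq_add (count_size _ _) (count_size _ _)) _.
    by rewrite size_enum_neq sizeE; lia.
  rewrite -[X in (_ <= X)%N]addn0; apply: leq_add.
    by rewrite -[leqRHS]sizeE count_size.
  rewrite leqn0 count_filter (@eq_count _ _ pred0) ?count_pred0// => k /=.
  rewrite mem_shield_step; apply/negbTE/negP => /andP[/orP[|/andP[_]]] h ki; move: h.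
    rewrite subr_eq (inj_eq (addrI _)) (inj_eq unitv_inj) eq_sym => ik.
    by rewrite ik in ki.
  by rewrite (inj_eq (addIr _)) (inj_eq (addrI _)) (inj_eq unitv_inj) (negPf ij).
have [meet|nmeet] := eqVneq (x + e_ i) (y + e_ j).
  apply: (@leq_trans (1 + d.-1)); last by rewrite add1n prednK.
  apply: leq_add; last by rewrite -(size_enum_neq i) count_size.
  apply: leq_trans (leq_b1 [exists k, x + e_ k == y + e_ j]).
  apply: leq_trans (count_le_exists (enum_uniq _) (@inj x (y + e_ j))).
  apply: sub_count => k /=; rewrite mem_shield_step (negPf xy)/= => /andP[_].
  by rewrite -subr_eq0 opprB addrA subr_eq0.
apply: leq_add.
  apply: leq_trans (count_le_exists (enum_uniq _) (@inj x (y + e_ j))).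
  apply: sub_count => k /=; rewrite mem_shield_step (negPf xy)/= => /andP[_].
  by rewrite -subr_eq0 opprB addrA subr_eq0.
apply: leq_trans (count_le_exists (enum_uniq _) (@inj y (x + e_ i))).
rewrite count_filter; apply: sub_count => k /=; rewrite mem_shield_step.
move=> /andP[/orP[|/andP[_]]].
  by rewrite subr_eq eq_sym.
by rewrite (inj_eq (addIr _)) (negPf nmeet).
Qed.

Lemma shield_step_union x y i j :
  (2 * (2 * d).-1 <= size (undup (shield_step x i ++ shield_step y j)) + overlap x y i j)%N.
Proof.
have := shield_step_overlap x y i j.
have := count_predC (mem (shield_step y j)) (shield_step x i).
rewrite undup_cat size_cat !undup_id ?shield_step_uniq// !shield_step_size size_filter.
set a := count _ _; set b := count (predC _) _.
lia.
Qed.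

(** A common edge away from common vertices requires x - y to be a root vector
    e_a - e_b, and then that the letter of one word be b, or that the letter of
    the other be a. *)
Lemma below_root a b j : a != b ->
  below (root_vec a b) (e_ j) = (j == a).
Proof.
move=> ab; apply/existsP/eqP => [[k]|->]; last by exists b; rewrite /root_vec subrK.
have [->//|ja] := eqVneq j a; move=> /eqP/rowP/(_ a).
by rewrite !mxE !eqxx/= (negPf ab) [a == j]eq_sym (negPf ja); case: eqP.
Qed.

Lemma below_shift (x y z : vertex d) : below x z = below (x - y) (z - y).
Proof.
by apply: eq_existsb => k; rewrite addrAC (inj_eq (addIr _)).
Qed.

Variables (q c a X : R).
Hypothesis q0 : 0 < q.
Hypothesis q1 : q <= 1.
Hypothesis cE : c = q^-1.
Hypothesis a0 : 0 <= a.
Hypothesis X1 : 1 <= X.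

(** The value X at the origin replaces 1 + a G(0): being smaller, it leaves room
    at the root vectors for the weight of a meeting. *)
Definition potential (z : vertex d) : R := if z == 0 then X else 1 + a * G z.

Lemma potential_ge1 z : 1 <= potential z.
Proof.
rewrite /potential; case: eqVneq => // _.
by rewrite lerDl mulr_ge0// green_ge0.
Qed.

Variable (g : R).
Hypothesis gE : forall i j, i != j -> G (root_vec i j) = g.
Hypothesis super_root :
  c ^+ d * X + 2 * (d%:R - 1) * (c - 1) * (1 + a * g) <= 1 + a * G 0.
Hypothesis super_0 :
  t * c ^+ (2 * d).-1 * X + (1 - t) * c ^+ d * (1 + a * g) <= X.

Lemma shield_weight_le x y i j :
  q ^+ size (undup (shield_step x i ++ shield_step y j)) <=
  q ^+ (2 * (2 * d).-1) * c ^+ overlap x y i j.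
Proof.
set n := size _; set m := (2 * _)%N; set o := overlap _ _ _ _.
have mno : (m <= n + o)%N by exact: shield_step_union.
rewrite cE exprVn ler_pdivlMr ?exprn_gt0// -exprD.
by apply: ler_wiXn2l => //; exact: ltW.
Qed.

(** Off the diagonal and the root vectors, G is harmonic and no edge is shared.
    At a root vector, one of the d^2 pairs of letters leads to a meeting and
    2 (d - 1) pairs share one edge and lead to a root vector, where G takes the
    same value g; this is the condition [super_root]. On the diagonal, the
    condition is [super_0]. *)
Lemma shield_super x y :
  avg (fun i => avg (fun j =>
    q ^+ size (undup (shield_step x i ++ shield_step y j)) *
    potential (x + e_ i - (y + e_ j)))) <=
  q ^+ (2 * (2 * d).-1) * potential (x - y).
Proof.
have p0 z : 0 <= potential z by apply: le_trans (potential_ge1 z).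
have c0 : 0 < c by rewrite cE invr_gt0.
have c1 : 1 <= c by rewrite cE invf_ge1.
apply: (@le_trans _ _ (avg (fun i => avg (fun j => q ^+ (2 * (2 * d).-1) *
   (c ^+ overlap x y i j * potential (x + e_ i - (y + e_ j))))))).
  by apply: le_avg2 => i j; rewrite mulrA ler_wpM2r// shield_weight_le.
rewrite avg2Z ler_pM2l ?exprn_gt0//.
have zE i j : x + e_ i - (y + e_ j) = (x - y) + e_ i - e_ j.
  by rewrite opprD addrACA addrA.
have meetE i j : (x + e_ i == y + e_ j) = ((x - y) + e_ i - e_ j == 0).
  by rewrite -zE subr_eq0.
have [xy|xy] := eqVneq x y.
  rewrite (eq_avg2 (g := fun i j => c ^+ d * (1 + a * g) +
     (c ^+ (2 * d).-1 * X - c ^+ d * (1 + a * g)) * (j == i)%:R)).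
    rewrite xy subrr /potential eqxx !avg2D !avg2Z avg2_diag !avg_cst//.
    by move: super_0; lra.
  move=> i j; rewrite zE /overlap xy eqxx subrr add0r [i == j]eq_sym /potential.
  have [->|ji] := eqVneq j i; first by rewrite subrr eqxx /=; ring.
  rewrite subr_eq0 (inj_eq unitv_inj) eq_sym (negPf ji) gE 1?eq_sym//.
  by rewrite mulr0 addr0.
have z0 : x - y != 0 by rewrite subr_eq0.
have [/existsP[a' /existsP[b ab]]|nroot] :=
    boolP [exists a', exists b, (a' != b) && (x - y == root_vec a' b)]; last first.
  (* The walks are too far apart to meet or to share an edge at this step. *)
  have nr i j : (x - y) + e_ i != e_ j.
    apply: contraNneq nroot => h; apply/existsP; exists j; apply/existsP; exists i.
    rewrite /root_vec -h addrK eqxx andbT; apply: contraNneq z0 => ji.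
    by move/eqP: h; rewrite ji -[X in _ == X]add0r (inj_eq (addIr _)).
  rewrite (eq_avg2 (g := fun i j => 1 + a * G ((x - y) + e_ i - e_ j))).
    rewrite avg2_green /potential (negPf z0) /at_origin (negPf z0) subr0//.
  move=> i j; rewrite /overlap (negPf xy) meetE zE subr_eq0 (negPf (nr i j)).
  rewrite /potential subr_eq0 (negPf (nr i j)) (_ : below _ _ = false); last first.
    apply/existsP => -[k]; rewrite -subr_eq0 opprD addrA [x + _ - y]addrAC subr_eq0.
    by rewrite (negPf (nr _ _)).
  rewrite (_ : below _ _ = false) ?mul1r//; apply/existsP => -[k].
  rewrite eq_sym -subr_eq0 opprD addrA [x + _ - y]addrAC subr_eq0.
  by rewrite (negPf (nr _ _)).
move: ab => /andP[ab /eqP xyE].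
(* K1 corrects the term of the pair of letters that leads to a meeting, K2 the
   terms of the pairs that share one edge. *)
pose K1 := c ^+ d * X - (1 + a * G 0); pose K2 := (c - 1) * (1 + a * g).
rewrite (eq_avg2 (g := fun i j => (1 + a * G ((x - y) + e_ i - e_ j)) +
   (K1 * ((i == b)%:R * (j == a')%:R) + K2 * ((i == b)%:R * (1 - (j == a')%:R)) +
    K2 * ((1 - (i == b)%:R) * (j == a')%:R)))).
  rewrite avg2D avg2_green /potential (negPf z0) /at_origin (negPf z0) subr0 gerDl.
  rewrite !avg2D !avg2Z !avg_prod avg_delta.
  have avgB (k : 'I_d) : avg (fun i => 1 - (i == k)%:R) = 1 - t.
    rewrite (eq_avg (g := fun i => 1 + -1 * (i == k)%:R)).
      by rewrite avgD avgZ avg_cst// avg_delta; ring.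
    by move=> i; ring.
  rewrite !avgB !avg_delta.
  have -> : K1 * (t * t) + K2 * (t * (1 - t)) + K2 * ((1 - t) * t) =
     t ^+ 2 * (K1 + 2 * (d%:R - 1) * K2).
    by field; rewrite gt_eqF.
  rewrite pmulr_rle0 ?exprn_gt0 ?invr_gt0//.
  by rewrite /K1 /K2; move: super_root; lra.
move=> i j; rewrite /overlap (negPf xy) meetE zE.
have -> : below x (y + e_ j) = (j == a').
  by rewrite (below_shift _ y) xyE addrAC subrr add0r below_root.
have -> : below y (x + e_ i) = (i == b).
  rewrite (below_shift _ x) -opprB xyE /root_vec opprB addrAC subrr add0r below_root//.
  by rewrite eq_sym.
rewrite /potential xyE /root_vec.
have [->|ib] := eqVneq i b; have [->|ja] := eqVneq j a'.
- rewrite subrK subrr eqxx /K1 /=; ring.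
- rewrite subrK subr_eq0 (inj_eq unitv_inj) eq_sym (negPf ja) /= gE 1?eq_sym// /K2; ring.
- rewrite -addrA [e_ i - _]addrC addrACA subrr add0r addrC subr_eq0 (inj_eq unitv_inj) (negPf ib)/= gE// /K2; ring.
- case: eqVneq => [h|_] /=; last by ring.
  move/rowP/(_ a'): h; rewrite !mxE !eqxx/= (negPf ab) [a' == j]eq_sym (negPf ja).
  by case: (a' == i).
Qed.

End supersolutions.

(** * Arbitrarily long good words have positive probability *)

Section positivity.
Variables (R : realType) (d : nat).
Hypothesis d_ge10 : (10 <= d)%N.

Let d_gt0 : (0 < d)%N. Proof. exact: leq_trans d_ge10. Qed.
Let dR_gt0 : 0 < d%:R :> R. Proof. by rewrite ltr0n. Qed.

Local Notation t := (d%:R^-1 : R).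

(** X is determined by equality in the first constraint; the second one is then
    affine in a, with a positive leading coefficient by the hypothesis on G
    and g. So a large a works. *)
Lemma potential_params (c G g : R) : 0 < c ->
  c ^+ (2 * d) * ((1 - t) * g) <
    (1 - t * c ^+ (2 * d).-1) * (G - 2 * (d%:R - 1) * (c - 1) * g) ->
  0 < 1 - t * c ^+ (2 * d).-1 -> 0 <= (1 - t) * g ->
  exists a X, [/\ 0 <= a, 1 <= X,
    c ^+ d * X + 2 * (d%:R - 1) * (c - 1) * (1 + a * g) <= 1 + a * G &
    t * c ^+ (2 * d).-1 * X + (1 - t) * c ^+ d * (1 + a * g) <= X].
Proof.
move=> c0 strict D0 g0.
set D := 1 - _ * _ in strict D0; set k := 2 * (d%:R - 1) * (c - 1) in strict *.
have C0 : 0 < c ^+ d by exact: exprn_gt0.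
set A := G - k * g in strict.
have A0 : 0 < A.
  rewrite -(pmulr_rgt0 _ D0); apply: le_lt_trans strict.
  by rewrite mulr_ge0// exprn_ge0// ltW.
set s := c ^+ (2 * d) * ((1 - t) * g) in strict.
have [a [a0 aA aD]] : exists a, [/\ 0 <= a, c ^+ d - (1 - k) <= a * A &
    c ^+ (2 * d) * (1 - t) - D * (1 - k) <= a * (D * A - s)].
  have E0 : 0 < D * A - s by rewrite subr_gt0.
  exists (`|(c ^+ d - (1 - k)) / A| + `|(c ^+ (2 * d) * (1 - t) - D * (1 - k)) / (D * A - s)|).
  split; first by rewrite addr_ge0.
  - rewrite -ler_pdivrMr//; apply: le_trans (ler_norm _) _; by rewrite lerDl.
  - rewrite -ler_pdivrMr//; apply: le_trans (ler_norm _) _; by rewrite lerDr.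
exists a, (c ^- d * ((1 - k) + a * A)); split => //.
- rewrite mulrC ler_pdivlMr// mul1r; lra.
- by rewrite mulrA mulfV ?gt_eqF// mul1r /A; lra.
rewrite -subr_ge0 -(pmulr_rge0 _ C0).
have Y : c ^+ (2 * d) = c ^+ d * c ^+ d by rewrite mul2n -addnn exprD.
rewrite [leRHS](_ : _ = D * (1 - k + a * A) - c ^+ (2 * d) * (1 - t) * (1 + a * g)).
  by move: aD; rewrite /s; lra.
by rewrite Y /D; field; rewrite !gt_eqF.
Qed.

(** The value of 1 / (1 - p) at which infinite clusters are shown to exist: its
    last coefficient lies strictly between that of 1 + t * [green_bound], which
    is 4, and that of [shield_c], so that both comparisons are strict. *)
Definition open_c : R := 1 + t + t ^+ 2 + 41 / 10 * t ^+ 3.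

Let t_gt0 : 0 < t. Proof. by rewrite invr_gt0. Qed.

Lemma open_c_lt : 1 < open_c < shield_c t.
Proof.
have := exprn_gt0 2 t_gt0; have := exprn_gt0 3 t_gt0.
by rewrite /open_c /shield_c => ? ?; have := t_gt0 => ?; apply/andP; split; lra.
Qed.

Lemma prob_open_words :
  (0 < bond_percolation d (1 - open_c^-1)
     (\bigcap_n has_good_word (@open_step d) true 0%R n))%E.
Proof.
have /andP[c1 _] := open_c_lt.
have c0 : 0 < open_c by lra.
have p0 : 0 < 1 - open_c^-1 by rewrite subr_gt0 invf_lt1.
have p1 : 1 - open_c^-1 <= 1 by rewrite gerBl invr_ge0 ltW.
pose k := (1 - (1 - open_c^-1)) / ((1 - open_c^-1) * d%:R).
have kE : k = (d%:R * (open_c - 1))^-1.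
  by rewrite /k; field; rewrite !gt_eqF//=; lra.
have kG : k * green R (0 : vertex d) < 1.
  rewrite kE mulrC ltr_pdivrMr ?mulr_gt0 ?subr_gt0// mul1r.
  apply: le_lt_trans (green_le R d_ge10 (0 : vertex d)) _.
  rewrite [ltRHS](_ : _ = d%:R * t * (1 + t + 41 / 10 * t ^+ 2)); last by rewrite /open_c; ring.
  rewrite divff ?gt_eqF// mul1r /green_bound.
  by have := exprn_gt0 2 t_gt0; lra.
have k0 : 0 <= k by rewrite kE invr_ge0 mulr_ge0// subr_ge0 ltW.
pose a := k / (1 - k * green R (0 : vertex d)).
have a0 : 0 <= a by rewrite divr_ge0// subr_ge0 ltW.
have aE : k * (1 + a * green R (0 : vertex d)) <= a.
  by rewrite le_eqVlt; apply/orP; left; apply/eqP; rewrite /a; field; rewrite gt_eqF// subr_gt0.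
apply: (@prob_good_words_of_all_sizes R d d_gt0 (@open_step d) 1 _ _ (1 - open_c^-1)
  (fun x y => 1 + a * green R (x - y))) => //.
- by move=> x i e; rewrite inE => /eqP->.
- by move=> x y; rewrite lerDl mulr_ge0// green_ge0.
- by move=> x y _; exact: (open_super d_ge10 p0 p1 aE).
- by rewrite ltW.
Qed.

Lemma prob_shield_words :
  (0 < bond_percolation d (1 - (shield_c t)^-1)
     (\bigcap_n has_good_word (@shield_step d) false 0%R n))%E.
Proof.
set c := shield_c t.
have c1 : 1 < c by have /andP[] := open_c_lt; exact: lt_trans.
have c0 : 0 < c by lra.
have [i [j ij]] : exists i, exists j : 'I_d, i != j.
  exists (Ordinal d_gt0); exists (Ordinal (leq_trans (isT : (1 < 10)%N) d_ge10)).
  by rewrite -val_eqE.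
pose g : R := green R (root_vec i j).
have gE (k l : 'I_d) : k != l -> green R (root_vec k l) = g by move=> kl; exact: green_root.
have rE : (1 - t) * g = (1 - t) * green R (0 : vertex d) - 1.
  exact: (green_root_vec R d_ge10 ij).
have t1 : t < 1 by rewrite invf_lt1// ltr1n; exact: leq_trans d_ge10.
have r0 : 0 <= (1 - t) * g by rewrite mulr_ge0 ?green_ge0// subr_ge0 ltW.
have [D0 strict] : 0 < 1 - t * c ^+ (2 * d).-1 /\ c ^+ (2 * d) * ((1 - t) * g) <
    (1 - t * c ^+ (2 * d).-1) * (green R (0 : vertex d) - 2 * (d%:R - 1) * (c - 1) * g).
  have := @shield_ineq R d (green R (0 : vertex d)) d_ge10 (green_le R d_ge10 (0 : vertex d)).
  rewrite -rE => /(_ r0); rewrite -/c => -[D0 strict]; split => //; move: strict.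
  by rewrite [2 * d%:R * _ * _](_ : _ = 2 * (d%:R - 1) * (c - 1) * g)//; field; rewrite gt_eqF.
have [a [X [a0 X1 s1 s2]]] := potential_params c0 strict D0 r0.
have q0 : 0 < c^-1 by rewrite invr_gt0.
have q1 : c^-1 <= 1 by rewrite invf_le1// ltW.
have cE : c = c^-1^-1 by rewrite invrK.
apply: (@prob_good_words_of_all_sizes R d d_gt0 (@shield_step d) (2 * d).-1 _ _ c^-1
  (fun x y => potential a X (x - y))) => //.
- exact: shield_step_level.
- by move=> x k; rewrite undup_id ?shield_step_uniq// shield_step_size.
- by move=> x y; exact: potential_ge1.
- by move=> x y _; exact: (shield_super d_ge10 q0 q1 cE a0 X1 gE s1 s2).
- by rewrite subr_ge0 q1 gerBl ltW.
- by rewrite subKr.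
Qed.
End positivity.

(** * Infinite branches and measurability of the percolation events *)

Section konig.
Variables (T : eqType) (tree : seq T -> Prop) (children : seq T -> seq T).
Hypothesis tree_prefix : forall s x, tree (rcons s x) -> tree s.
Hypothesis tree_branching : forall s x, tree (rcons s x) -> x \in children s.

Lemma tree_catl s u : tree (s ++ u) -> tree s.
Proof.
elim/last_ind: u => [|u x ih]; first by rewrite cats0.
by rewrite -rcons_cat => /tree_prefix.
Qed.

(** Koenig's lemma: a node with descendants at every depth has a child with
    the same property, since it has finitely many children. *)
Lemma konig : (forall n, exists2 s, size s = n & tree s) ->
  exists v : nat -> T, forall n, tree (mkseq v n).
Proof.
move=> big; pose deep s := forall n, exists2 u, size u = n & tree (s ++ u).
have step s : deep s -> exists x, deep (rcons s x).
  move=> ds; apply: contrapT => /forallNP nd.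
  have [m hm] : {m : T -> nat & forall x u, size u = m x -> ~ tree (rcons s x ++ u)}.
    apply: (@choice T nat (fun x n => forall u, size u = n -> ~ tree (rcons s x ++ u))) => x.
    have /existsNP[n hn] := nd x; exists n => u un tu; apply: hn.
    by exists u.
  have [[|x u] //= [uN] tu] := ds (\max_(x <- children s) m x).+1.
  have tsx : tree (rcons s x) by apply: (@tree_catl _ u); rewrite cat_rcons.
  apply: (hm x (take (m x) u)).
    by rewrite size_takel// uN; apply: leq_bigmax_seq => //; exact: tree_branching.
  by apply: (@tree_catl _ (drop (m x) u)); rewrite -catA cat_take_drop cat_rcons.
have [f hf] : {f : seq T -> option T & forall s, deep s ->
    if f s is Some x then deep (rcons s x) else False}.
  apply: (@choice _ _ (fun s o => deep s -> if o is Some x then deep (rcons s x) else False)) => s.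
  by have [/step[x dx]|nd] := pselect (deep s); [exists (Some x)|exists None].
have d0 : deep [::] by move=> n; have [s sn ts] := big n; exists s.
have [x0 _] := step _ d0.
pose g s := odflt x0 (f s).
have hg s : deep s -> deep (rcons s (g s)) by move=> /hf; rewrite /g; case: (f s).
pose S n := iter n (fun s => rcons s (g s)) [::].
have dS n : deep (S n) by elim: n => [//|n ih]; exact: hg.
exists (g \o S) => n; rewrite (_ : mkseq _ _ = S n).
  by have [u _] := dS n 0%N; exact: tree_catl.
by elim: n => [//|n ih]; rewrite mkseqS ih.
Qed.
End konig.

Section countable_measurability.
Context d (T : measurableType d) (K : countType).

Lemma measurable_exists (A : K -> set T) : (forall k, measurable (A k)) ->
  measurable [set x | exists k, A k x].
Proof.
move=> mA; rewrite (_ : [set x | _] = \bigcup_k A k).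
  by apply: countable_bigcupT_measurable => //; exact: countableP.
by apply/seteqP; split=> x [k]; exists k.
Qed.

Lemma measurable_forall (A : K -> set T) : (forall k, measurable (A k)) ->
  measurable [set x | forall k, A k x].
Proof.
move=> mA; rewrite (_ : [set x | _] = ~` [set x | exists k, (~` A k) x]).
  by apply: measurableC; apply: measurable_exists => k; exact: measurableC.
apply/seteqP; split=> x /=; first by move=> h [k]; apply.
by move=> h k; apply: contrapT => nA; apply: h; exists k.
Qed.

Lemma measurable_prop (P : Prop) : measurable [set x : T | P].
Proof.
have [p|np] := pselect P.
  by rewrite (_ : [set x | P] = setT)//; apply/seteqP; split.
by rewrite (_ : [set x | P] = set0)//; apply/seteqP; split.
Qed.
End countable_measurability.

Lemma infinite_setPpickle (K : countType) (S : set K) :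
  infinite_set S <-> forall n : nat, exists y, S y /\ (n <= pickle y)%N.
Proof.
split=> [iS n|h].
  apply: contrapT => nh; apply: iS.
  apply: (@sub_finite_set _ _ (pickle @^-1` `I_n)).
    by move=> y Sy /=; rewrite ltnNge; apply/negP => ny; apply: nh; exists y.
  apply: finite_preimage; last exact: finite_II.
  by move=> x y _ _; exact: (pcan_inj pickleK).
move=> /finite_seqP[s sE]; have [y []] := h (\max_(x <- s) pickle x).+1.
by rewrite sE /= ltnNge => ys /negP; apply; exact: leq_bigmax_seq.
Qed.

Lemma infinite_set_inj (K : Type) (S : set K) (v : nat -> K) :
  injective v -> (forall n, S (v n)) -> infinite_set S.
Proof.
move=> vi vS fS; apply: infinite_nat.
rewrite (_ : setT = v @^-1` S); last by apply/seteqP; split=> // n _; exact: vS.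
by apply: finite_preimage => // x y _ _; exact: vi.
Qed.

Section components.
Variables (dT : measure_display) (T : measurableType dT) (d : nat).
Variable r : T -> rel (vertex d).
Hypothesis mr : forall x y, measurable [set w | r w x y].

Lemma measurable_path x s : measurable [set w | path (r w) x s].
Proof.
elim: s x => [|y s ih] x; first exact: (measurable_prop _ true).
rewrite (_ : [set w | _] = [set w | r w x y] `&` [set w | path (r w) y s]).
  exact: measurableI.
by apply/seteqP; split=> w /= /andP.
Qed.

Lemma measurable_component x y : measurable [set w | component (r w) x y].
Proof.
rewrite (_ : [set w | _] =
    [set w | exists s : seq (vertex d), ([set w | path (r w) x s] `&` [set w | last x s = y]) w]).
  apply: measurable_exists => s; apply: measurableI; last exact: measurable_prop.
  exact: measurable_path.
by apply/seteqP; split=> w [s]; [exists s|case; exists s].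
Qed.

Lemma measurable_infinite_component x : measurable [set w | infinite_set (component (r w) x)].
Proof.
rewrite (_ : [set w | _] = [set w | forall n : nat,
    [set w | exists y : vertex d, ([set w | component (r w) x y] `&` [set w | n <= pickle y]%N) w] w]).
  apply: measurable_forall => n; apply: measurable_exists => y.
  by apply: measurableI; [exact: measurable_component|exact: measurable_prop].
by apply/seteqP; split=> w /=; rewrite infinite_setPpickle.
Qed.
End components.

Section events.
Variable d : nat.

Lemma measurable_open_edge (e : edge d) : measurable [set c : configuration d | c e].
Proof. exact: (measurable_edge e true). Qed.

Lemma measurable_open_adj (x y : vertex d) :
  measurable [set c : configuration d | open_adj c x y].
Proof.
rewrite (_ : [set c | _] = [set c : configuration d | exists e : edge d,
    ([set c | joins e x y] `&` [set c : configuration d | c e]) c]).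
  apply: measurable_exists => e; apply: measurableI; first exact: measurable_prop.
  exact: measurable_open_edge.
by apply/seteqP; split=> c /= => [/asboolP[e]|[e []]]; [exists e|move=> *; apply/asboolP; exists e].
Qed.

Lemma measurable_infinite_cluster (x : vertex d) :
  measurable [set c : configuration d | infinite_set (Defs.cluster c x)].
Proof. exact: (measurable_infinite_component measurable_open_adj). Qed.

Lemma measurable_has_infinite_cluster : measurable (@has_infinite_cluster d).
Proof. by apply: measurable_exists => x; exact: measurable_infinite_cluster. Qed.

Lemma measurable_X_vertex (x : vertex d) : measurable [set c : configuration d | X_vertex c x].
Proof. by apply: measurableC; exact: measurable_infinite_cluster. Qed.

Lemma measurable_X_adj (x y : vertex d) :
  measurable [set c : configuration d | X_adj c x y].
Proof.
rewrite (_ : [set c | _] = [set c : configuration d | neighbor x y] `&`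
    ([set c : configuration d | X_vertex c x] `&` [set c : configuration d | X_vertex c y])).
  apply: measurableI; first exact: measurable_prop.
  by apply: measurableI; exact: measurable_X_vertex.
by apply/seteqP; split=> c /= => [/asboolP[]|[? [? ?]]] //; apply/asboolP.
Qed.

Lemma measurable_X_has_infinite_component : measurable (@X_has_infinite_component d).
Proof.
rewrite (_ : @X_has_infinite_component d = [set c : configuration d | exists x : vertex d,
    ([set c : configuration d | X_vertex c x] `&`
     [set c : configuration d | infinite_set (component (X_adj c) x)]) c]).
  apply: measurable_exists => x; apply: measurableI; first exact: measurable_X_vertex.
  exact: (measurable_infinite_component measurable_X_adj).
by apply/seteqP; split=> c [x]; [exists x|case; exists x].
Qed.

Lemma measurable_shielded (x : vertex d) : measurable [set c : configuration d | shielded c x].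
Proof.
apply: measurable_forall => e.
rewrite (_ : (fun c => _) = [set c : configuration d | ~ incident e x] `|` [set c : configuration d | c e = false]).
  apply: measurableU; first exact: measurable_prop.
  exact: measurable_edge.
apply/seteqP; split=> c /=.
  by move=> h; have [/h/negbTE|] := boolP (incident e x); [right|left; exact/negP].
by move=> [h /h//|->].
Qed.

End events.

(** * From good words to infinite clusters and infinite shielded paths *)

Section paths.
Variable d : nat.
Local Notation e_ := (@unitv d).

Lemma neighbor_unitv (x : vertex d) i : neighbor x (x + e_ i).
Proof.
rewrite /neighbor (bigD1 i)//= big1 ?addr0 => [|j /negPf ji].
  by rewrite !mxE !eqxx opprD addrA subrr add0r normrN.
by rewrite !mxE ji andbF addr0 subrr normr0.
Qed.

Definition neighbors (x : vertex d) : seq (vertex d) :=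
  [seq x + e_ i | i <- enum 'I_d] ++ [seq x - e_ i | i <- enum 'I_d].

Lemma mem_neighbors x y : neighbor x y -> y \in neighbors x.
Proof.
move=> /neighborP[[z i] [/orP[]/andP[/eqP <- /eqP <-] _]]; rewrite mem_cat.
  by apply/orP; left; apply: map_f; rewrite mem_enum.
apply/orP; right; apply/mapP; exists i; first by rewrite mem_enum.
by rewrite /endpoint1 /endpoint2 /= addrK.
Qed.

(** By Koenig's lemma the event only depends on the existence of finite
    self-avoiding shielded paths of all lengths from some vertex, which is a
    countable combination of cylinder events. *)
Lemma measurable_has_infinite_shielded_path : measurable (@has_infinite_shielded_path d).
Proof.
pose spath (c : configuration d) (x : vertex d) (s : seq (vertex d)) :=
  [/\ uniq (x :: s), path (@neighbor d) x s & forall y, y \in x :: s -> shielded c y].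
rewrite (_ : @has_infinite_shielded_path d = [set c : configuration d |
    exists x : vertex d, [set c | forall n : nat, [set c | exists s : seq (vertex d),
      ([set c : configuration d | [/\ size s = n, uniq (x :: s) & path (@neighbor d) x s]] `&`
       [set c : configuration d | forall y : vertex d,
          ([set c : configuration d | y \notin x :: s] `|` [set c : configuration d | shielded c y]) c])
      c] c] c]).
  apply: measurable_exists => x; apply: measurable_forall => n.
  apply: measurable_exists => s; apply: measurableI; first exact: measurable_prop.
  apply: measurable_forall => y; apply: measurableU; first exact: measurable_prop.
  exact: measurable_shielded.
apply/seteqP; split=> [c [v [vi vn vs]]|c /= [x xc]].
  exists (v 0%N) => n; exists (mkseq (v \o S) n).
  have cE : v 0%N :: mkseq (v \o S) n = mkseq v n.+1.
    by rewrite /mkseq /= (iotaDl 1 0) -map_comp.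
  split.
    split; rewrite ?size_mkseq ?cE ?mkseq_uniq//.
    apply/(pathP (v 0%N)) => i; rewrite size_mkseq => ni.
    by rewrite cE !nth_mkseq// ltnW.
  move=> y; have [|] := boolP (y \in _); last by left.
  by rewrite cE => /mapP[k _ ->]; right; exact: vs.
have [||n|v hv] := @konig _ (spath c x) (fun s => neighbors (last x s)).
- move=> s y [u p h]; split.
  + by move: u; rewrite -rcons_cons rcons_uniq => /andP[].
  + by move: p; rewrite rcons_path => /andP[].
  + by move=> z zs; apply: h; rewrite -rcons_cons mem_rcons inE zs orbT.
- by move=> s y [_ + _]; rewrite rcons_path => /andP[_ /mem_neighbors].
- have [s [[sn u p] h]] := xc n; exists s => //; split=> // y ys.
  by have [|//] := h y; rewrite ys.
pose w n := if n is n'.+1 then v n' else x.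
have wE n : x :: mkseq v n = mkseq w n.+1 by rewrite /mkseq /= (iotaDl 1 0) -map_comp.
exists w; split.
- move=> m n mn; have [u _ _] := hv (maxn m n); rewrite wE in u.
  have mk : (m < (maxn m n).+1)%N by rewrite ltnS leq_maxl.
  have nk : (n < (maxn m n).+1)%N by rewrite ltnS leq_maxr.
  apply/eqP; rewrite -(nth_uniq x _ _ u) ?size_mkseq// !nth_mkseq//.
  exact/eqP.
- move=> n; have [_ /(pathP x)/(_ n) + _] := hv n.+1.
  by rewrite size_mkseq wE !nth_mkseq//; apply.
- move=> n; have [_ _ h] := hv n; apply: h; rewrite wE.
  by apply/mapP; exists n; rewrite // mem_iota add0n ltnSn.
Qed.

Lemma good_open_word_path (c : configuration d) x w :
  good_word (@open_step d) true x w c -> exists2 y, Defs.cluster c x y & level y = level x + (size w)%:Z.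
Proof.
elim: w x => [|i w ih] x h; first by exists x; rewrite ?addr0//; exists [::].
have [|y [s ps <-] ly] := ih (x + e_ i).
  by move=> e ew; apply: h; rewrite mem_cat ew orbT.
exists (last (x + e_ i) s); last by rewrite ly level_unitv -addrA.
exists (x + e_ i :: s) => //=; rewrite ps andbT; apply/asboolP.
exists (x, i); first by rewrite /joins /endpoint1 /endpoint2 !eqxx.
by apply: h; rewrite mem_cat inE eqxx.
Qed.
(** The cluster of the origin reaches every level. *)
Lemma open_words_infinite_cluster :
  \bigcap_n has_good_word (@open_step d) true 0 n `<=` @has_infinite_cluster d.
Proof.
move=> c hc; exists 0.
have [v hv] : {v : nat -> vertex d & forall n, Defs.cluster c 0 (v n) /\ level (v n) = n%:Z}.
  apply: (@choice _ _ (fun n y => Defs.cluster c 0 y /\ level y = n%:Z)) => n.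
  have [w wn /good_open_word_path[y cy ly]] := hc n I.
  exists y; split => //; rewrite ly; move: wn; rewrite mem_words => /eqP ->.
  by rewrite /level big1 ?add0r// => i _; rewrite mxE.
apply: (@infinite_set_inj _ _ v) => [m n mn|n]; last by have [] := hv n.
have [_ lm] := hv m; have [_ ln] := hv n; move: ln; rewrite -mn lm => -[].
by [].
Qed.

Definition walk_vertex (i : nat -> 'I_d) n : vertex d := \sum_(k < n) e_ (i k).

Lemma walk_vertexS i n : walk_vertex i n.+1 = walk_vertex i n + e_ (i n).
Proof. by rewrite /walk_vertex big_ord_recr. Qed.

Lemma word_edges_rcons (F : vertex d -> 'I_d -> seq (edge d)) x w i :
  word_edges F x (rcons w i) = word_edges F x w ++ F (x + \sum_(j <- w) e_ j) i.
Proof.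
elim: w x => [|j w ih] x /=; first by rewrite big_nil addr0 cats0.
by rewrite ih big_cons catA addrA.
Qed.

Lemma level_walk_vertex i n : level (walk_vertex i n) = n%:Z.
Proof.
elim: n => [|n ih]; last by rewrite walk_vertexS level_unitv ih intS addrC.
by rewrite /walk_vertex big_ord0 /level big1// => k _; rewrite mxE.
Qed.

(** The first vertex is dropped because the downward edges at the origin are
    not constrained. Levels make the path self-avoiding. *)
Lemma shield_words_infinite_path :
  \bigcap_n has_good_word (@shield_step d) false 0 n `<=` @has_infinite_shielded_path d.
Proof.
move=> c hc.
have [||n|i hi] := @konig _ (fun w => good_word (@shield_step d) false 0 w c) (fun=> enum 'I_d).
- by move=> s x h e es; apply: h; rewrite word_edges_rcons mem_cat es.
- by move=> s x _; rewrite mem_enum.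
- by have [w wn h] := hc n I; exists w => //; move: wn; rewrite mem_words => /eqP.
have closed n e : e \in shield_step (walk_vertex i n) (i n) -> c e = false.
  move=> en; apply: (hi n.+1); rewrite mkseqS word_edges_rcons mem_cat add0r.
  suff -> : \sum_(j <- mkseq i n) e_ j = walk_vertex i n by rewrite en orbT.
  by rewrite /walk_vertex big_map -(big_mkord xpredT (fun k => e_ (i k))) /index_iota subn0.
exists (fun n => walk_vertex i n.+1); split.
- move=> m n /(congr1 (@level d)); rewrite !level_walk_vertex => -[].
  by [].
- by move=> n; rewrite [X in neighbor _ X]walk_vertexS neighbor_unitv.
move=> n [v k] /orP[/eqP|/eqP]; rewrite /endpoint1 /endpoint2 /= => vE.
  by rewrite (closed n.+1)// mem_shield_step vE eqxx.
rewrite (closed n)// mem_shield_step; apply/orP.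
have {}vE : v = walk_vertex i n + e_ (i n) - e_ k by rewrite -walk_vertexS -vE addrK.
have [kE|ki] := eqVneq k (i n); last by right; rewrite vE eqxx.
by left; rewrite vE kE addrK.
Qed.

Lemma shielded_path_subset_X :
  @has_infinite_shielded_path d `<=` @X_has_infinite_component d.
Proof.
move=> c [v [vi vn vs]].
have Xv n : X_vertex c (v n).
  move=> inf; apply: inf; apply: (@sub_finite_set _ _ [set v n]); last exact: finite_set1.
  move=> y [[|z s] /=]; first by move=> _ <-.
  move=> /andP[/asboolP[e ej ce] _] _.
  have /vs : incident e (v n).
    by case/orP: ej => /andP[e1 e2]; rewrite /incident ?e1 ?e2 ?orbT.
  by rewrite ce.
exists (v 0%N) => //; apply: (@infinite_set_inj _ _ v) => // n.
exists (mkseq (v \o S) n); last first.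
  by case: n => [//|n]; rewrite mkseqS last_rcons.
elim: n => [//|n ih]; rewrite mkseqS rcons_path ih /=.
have -> : last (v 0%N) (mkseq (v \o S) n) = v n.
  by case: n {ih} => [//|n]; rewrite mkseqS last_rcons.
by apply/asboolP; split.
Qed.

End paths.

(** * Comparison of the thresholds *)

Theorem corollary1p5 (R : realType) (d : nat) (hd : (10 <= d)%N) :
  p_c R d < p_shield R d <= p_fin R d.
Proof.
have prob_sub (p : R) (A B : set (configuration d)) : measurable A -> measurable B ->
    A `<=` B -> (0 < bond_percolation d p A)%E -> (0 < bond_percolation d p B)%E.
  move=> mA mB AB A0; apply: lt_le_trans A0 _.
  by apply: le_measure => //; apply: mem_set.
have mwords F b : measurable (\bigcap_n has_good_word F b (0 : vertex d) n).
  by apply: bigcap_measurable => // n _; exact: measurable_seq_union (measurable_good_word _ _ _).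
have /andP[c1 cc] := open_c_lt R hd.
have c0 : 0 < open_c R d by apply: lt_trans c1.
have c2 : 1 < shield_c (d%:R^-1 : R) by apply: lt_trans cc.
have c20 : 0 < shield_c (d%:R^-1 : R) by apply: lt_trans cc.
have inv01 (c : R) : 1 < c -> 0 <= 1 - c^-1 <= 1.
  move=> c1'; have c0' : 0 < c by apply: lt_trans c1'.
  by rewrite subr_ge0 invf_le1// ltW//= gerBl invr_ge0 ltW.
have ub1 (A : set R) : has_ubound [set p | 0 <= p <= 1 /\ A p].
  by exists 1 => p [/andP[]].
have pc : p_c R d <= 1 - (open_c R d)^-1.
  apply: ge_inf; first by exists 0 => p [/andP[]].
  split; first exact: inv01.
  apply: prob_sub (@open_words_infinite_cluster d) (prob_open_words R hd) => //.
  exact: measurable_has_infinite_cluster.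
have ps : 0 <= 1 - (shield_c (d%:R^-1 : R))^-1 <= 1 /\
    (0 < bond_percolation d (1 - (shield_c (d%:R^-1 : R))^-1) (@has_infinite_shielded_path d))%E.
  split; first exact: inv01.
  apply: prob_sub (@shield_words_infinite_path d) (prob_shield_words R hd) => //.
  exact: measurable_has_infinite_shielded_path.
apply/andP; split.
  apply: le_lt_trans pc _; apply: (@lt_le_trans _ _ (1 - (shield_c (d%:R^-1 : R))^-1)).
    by rewrite ltrD2l ltrN2 ltf_pV2.
  exact: (ub_le_sup (ub1 _)) ps.
apply: ge_sup; first by exists (1 - (shield_c (d%:R^-1 : R))^-1).
move=> p [p01 pp]; apply: (ub_le_sup (ub1 _)); split => //.
apply: prob_sub (@shielded_path_subset_X d) pp.
  exact: measurable_has_infinite_shielded_path.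
exact: measurable_X_has_infinite_component.
Qed.
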